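(* Let $P$ and $P'$ be polyhedra each obtained from a box by a set of intrusions in one face (the box, the face, and the intrusions may a priori differ between $P$ and $P'$). If a finite set $M$ of point-normal markers is a marker-per-face markup of both $P$ and $P'$, then $P=P'$.
   Context: A box is a set $B=[a_1,b_1]\times[a_2,b_2]\times[a_3,b_3]$ with $a_i<b_i$. Let $F$ be a face of $B$, $n$ its outward unit normal, and $h$ the width of $B$ in the direction $n$. A polyhedron obtained from $B$ by a set of intrusions in the face $F$ is a set $P=\overline{B\setminus\bigcup_{j=1}^m K_j}$ where $r_1,\dots,r_m$ are pairwise disjoint closed rectangles contained in the relative interior of $F$ with sides parallel to the sides of $F$, $0<d_j\le h$, and $K_j=\{x-tn: x\in r_j,\ 0\le t\le d_j\}$ (if $d_j=h$ the intrusion goes all the way through $B$). Faces of a polyhedron $P$ are taken maximal: the closures of the connected components of the set of points of $\partial P$ having a neighbourhood in $\partial P$ contained in a single plane. A point-normal marker is a pair $(p,n)$ with $p\in\mathbb{R}^3$ and $n$ a unit vector; a finite set $M$ of them is a marker-per-face markup of $P$ if each $(p,n)\in M$ has $p$ on a face $F$ of $P$ with $n$ the outward unit normal of $P$ on $F$, and every face $F$ of $P$ contains the point of some marker in $M$ whose vector is the outward unit normal of $F$. *)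

(* Defs.v *)
From Stdlib Require Import Reals List.
Open Scope R_scope.

Record pt := mkpt { px : R; py : R; pz : R }.

Definition coord (p : pt) (i : nat) : R :=
  match i with 0%nat => px p | 1%nat => py p | _ => pz p end.

Definition vadd (p q : pt) : pt := mkpt (px p + px q) (py p + py q) (pz p + pz q).
Definition vscale (t : R) (p : pt) : pt := mkpt (t * px p) (t * py p) (t * pz p).
Definition vsub (p q : pt) : pt := vadd p (vscale (-1) q).
Definition dot (p q : pt) : R := px p * px q + py p * py q + pz p * pz q.
Definition dist (p q : pt) : R := sqrt (dot (vsub p q) (vsub p q)).

Definition basis (i : nat) : pt :=
  match i with 0%nat => mkpt 1 0 0 | 1%nat => mkpt 0 1 0 | _ => mkpt 0 0 1 end.

Definition pset := pt -> Prop.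

Definition closure (A : pset) : pset :=
  fun x => forall eps, 0 < eps -> exists y, A y /\ dist x y < eps.

Definition is_open (U : pset) : Prop :=
  forall x, U x -> exists eps, 0 < eps /\ forall y, dist x y < eps -> U y.

Definition boundary (A : pset) : pset :=
  fun x => forall eps, 0 < eps ->
    (exists y, A y /\ dist x y < eps) /\ (exists y, ~ A y /\ dist x y < eps).

Definition connected (A : pset) : Prop :=
  ~ exists U V : pset, is_open U /\ is_open V /\
      (forall x, A x -> U x \/ V x) /\
      (forall x, A x -> U x -> V x -> False) /\
      (exists x, A x /\ U x) /\ (exists x, A x /\ V x).

Definition component (A : pset) (x : pt) : pset :=
  fun y => exists C : pset, (forall z, C z -> A z) /\ connected C /\ C x /\ C y.

Definition in_plane (n : pt) (c : R) : pset := fun y => dot n y = c.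

Definition box (lo hi : pt) : pset :=
  fun x => forall i, (i < 3)%nat -> coord lo i <= coord x i <= coord hi i.

Definition valid_box (lo hi : pt) : Prop :=
  forall i, (i < 3)%nat -> coord lo i < coord hi i.

(* The face F of the box: axis i (< 3), side s (true = {x_i = b_i}, outward
   normal +e_i; false = {x_i = a_i}, outward normal -e_i). *)
Definition face_level (lo hi : pt) (i : nat) (s : bool) : R :=
  if s then coord hi i else coord lo i.

Definition face_normal (i : nat) (s : bool) : pt :=
  if s then basis i else vscale (-1) (basis i).

Definition rect (i : nat) (level : R) (c e : pt) : pset :=
  fun x => coord x i = level /\
    forall k, (k < 3)%nat -> k <> i -> coord c k <= coord x k <= coord e k.

Definition rect_in_relint (lo hi : pt) (i : nat) (c e : pt) : Prop :=
  forall k, (k < 3)%nat -> k <> i ->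
    coord lo k < coord c k /\ coord c k < coord e k /\ coord e k < coord hi k.

Definition intrusion (r : pset) (n : pt) (d : R) : pset :=
  fun y => exists x t, r x /\ 0 <= t <= d /\ y = vsub x (vscale t n).

(* An intrusion datum: rectangle corners (c, e) and depth d. *)
Definition intr_datum := (pt * pt * R)%type.

Definition intruded_box (P : pset) : Prop :=
  exists (lo hi : pt) (i : nat) (s : bool) (L : list intr_datum),
    valid_box lo hi /\ (i < 3)%nat /\
    (forall j, (j < length L)%nat ->
       let '(c, e, d) := nth j L (lo, hi, 0) in
       rect_in_relint lo hi i c e /\
       0 < d <= coord hi i - coord lo i) /\
    (forall j k, (j < length L)%nat -> (k < length L)%nat -> j <> k ->
       let '(c, e, _) := nth j L (lo, hi, 0) in
       let '(c', e', _) := nth k L (lo, hi, 0) in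
       forall x, ~ (rect i (face_level lo hi i s) c e x /\
                    rect i (face_level lo hi i s) c' e' x)) /\
    (forall x, P x <->
       closure (fun y => box lo hi y /\
                  ~ (exists j, (j < length L)%nat /\
                       let '(c, e, d) := nth j L (lo, hi, 0) in
                       intrusion (rect i (face_level lo hi i s) c e)
                                 (face_normal i s) d y)) x).

Definition flat_points (P : pset) : pset :=
  fun p => boundary P p /\
    exists eps n c, 0 < eps /\ n <> mkpt 0 0 0 /\
      forall y, dist p y < eps -> boundary P y -> in_plane n c y.

Definition is_face (P : pset) (F : pset) : Prop :=
  exists p, flat_points P p /\
    forall y, F y <-> closure (component (flat_points P) p) y.

Definition outward_normal (P : pset) (F : pset) (n : pt) : Prop :=
  dot n n = 1 /\
  (exists c, forall y, F y -> dot n y = c) /\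
  exists q, F q /\ exists eps, 0 < eps /\
    forall y, dist q y < eps ->
      (dot n y < dot n q -> P y) /\ (dot n q < dot n y -> ~ P y).

Definition marker := (pt * pt)%type.

Definition marker_per_face_markup (P : pset) (M : list marker) : Prop :=
  (forall m, In m M ->
     exists F, is_face P F /\ F (fst m) /\ outward_normal P F (snd m)) /\
  (forall F, is_face P F ->
     exists m, In m M /\ F (fst m) /\ outward_normal P F (snd m)).

(* Main.v *)
From Stdlib Require Import Reals List Lra Lia Classical.
Require Import Defs.
Open Scope R_scope.

(* Near a flat point P is a half-space, and along a face with a constant normal n the
   orientation cannot change, so every face carrying a marker with normal n consists of
   points where P is locally {y : dot n y <= c}. Hence the markers show the six planes of
   the box, and a marker with normal +-e_k strictly inside the box range of axis k lies on
   the corresponding side of some intrusion, in both polyhedra.  The intruded axis is the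
   only one lacking inner markers in one direction.  Projecting along it, the intrusions
   of P and P' become two finite families of disjoint rectangles such that each side of a
   rectangle of one family meets the same side of a rectangle of the other.  Such families
   coincide: the rectangle outside the common part with least (left end, right end) leads
   to a contradiction.  Floor markers then determine the depths. *)

(** * Two-dimensional uniqueness *)

(** Two features of the definitions shape the three-dimensional part. [outward_normal] attests its
    local inequality at a single point of the closure of a component, so the orientation must be
    propagated along the component before a marker can be read. And a marker may sit on an edge of
    its face, where the polyhedron is not a half-space; its hole is found at a nearby point of the
    component and then recovered from the closedness of the holes.

    The order by left end and then right end is dictated by the planar argument: rectangles of the
    other family that meet the minimal one may not start further left, and one that starts level
    with it reaches at least as far right. This stops a third rectangle from squeezing in between.

    Holes overshoot the box by a fixed amount. Thus no hole side lies in the plane of a box face,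
    and the open ends of two matched holes agree automatically. *)

Record rectangle := mkrect { xl : R; xr : R; yb : R; yt : R }.

Definition in_rect (X : rectangle) (x y : R) : Prop :=
  xl X <= x <= xr X /\ yb X <= y <= yt X.

Definition disjoint_family (G : list rectangle) : Prop :=
  forall X Y x y, In X G -> In Y G -> in_rect X x y -> in_rect Y x y -> X = Y.

(** The planar trace of a marker read in both polyhedra: a point on a side of [X] that lies on the
    same-named side of some [Y]. *)
Definition sides_touch (G H : list rectangle) : Prop :=
  forall X, In X G ->
    (exists Y y, In Y H /\ in_rect X (xl X) y /\ in_rect Y (xl X) y /\ xl Y = xl X) /\
    (exists Y y, In Y H /\ in_rect X (xr X) y /\ in_rect Y (xr X) y /\ xr Y = xr X) /\
    (exists Y x, In Y H /\ in_rect X x (yb X) /\ in_rect Y x (yb X) /\ yb Y = yb X) /\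
    (exists Y x, In Y H /\ in_rect X x (yt X) /\ in_rect Y x (yt X) /\ yt Y = yt X).

(** Reflection in the horizontal axis, which turns the exclusion of an overhang below into that of
    one above. *)
Definition flip_rect (X : rectangle) : rectangle :=
  mkrect (xl X) (xr X) (- yt X) (- yb X).

Lemma finite_argmin {A : Type} (l : list A) (f : A -> R) (Q : A -> Prop) :
  (exists x, In x l /\ Q x) ->
  exists x, In x l /\ Q x /\ forall y, In y l -> Q y -> f x <= f y.
Proof.
  induction l as [|a l IH]; intros [x [Hx Qx]]; [destruct Hx|].
  destruct (classic (exists x, In x l /\ Q x)) as [E|E].
  - destruct (IH E) as [m [Hm [Qm Hmin]]].
    destruct (classic (Q a /\ f a < f m)) as [[Qa Ha]|Hn].
    + exists a. split; [now left|]. split; [exact Qa|].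
      intros y [->|Hy] Qy; [lra|]. specialize (Hmin y Hy Qy). lra.
    + exists m. split; [now right|]. split; [exact Qm|].
      intros y [<-|Hy] Qy; [|now apply Hmin].
      destruct (Rle_or_lt (f m) (f a)) as [L|L]; [exact L|]. exfalso; tauto.
  - destruct Hx as [<-|Hx]; [|exfalso; eauto].
    exists a. split; [now left|]. split; [exact Qx|].
    intros y [<-|Hy] Qy; [lra|exfalso; eauto].
Qed.

Lemma disjoint_family_flip (G : list rectangle) :
  disjoint_family G -> disjoint_family (map flip_rect G).
Proof.
  intros D X Y x y HX HY IX IY.
  apply in_map_iff in HX as [X0 [<- HX]]. apply in_map_iff in HY as [Y0 [<- HY]].
  f_equal. apply (D X0 Y0 x (- y) HX HY);
    unfold in_rect in *; simpl in *; lra.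
Qed.

Lemma sides_touch_flip (G H : list rectangle) :
  sides_touch G H -> sides_touch (map flip_rect G) (map flip_rect H).
Proof.
  intros S X HX. apply in_map_iff in HX as [X0 [<- HX]].
  destruct (S X0 HX) as [[Y1 [y1 [I1 S1]]] [[Y2 [y2 [I2 S2]]]
    [[Y3 [x3 [I3 S3]]] [Y4 [x4 [I4 S4]]]]]].
  repeat split.
  - exists (flip_rect Y1), (- y1). split; [now apply in_map|].
    unfold in_rect in *; simpl in *; lra.
  - exists (flip_rect Y2), (- y2). split; [now apply in_map|].
    unfold in_rect in *; simpl in *; lra.
  - exists (flip_rect Y4), x4. split; [now apply in_map|].
    unfold in_rect in *; simpl in *; lra.
  - exists (flip_rect Y3), x3. split; [now apply in_map|].
    unfold in_rect in *; simpl in *; lra.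
Qed.

Lemma rectangle_ext (X Y : rectangle) :
  xl X = xl Y -> xr X = xr Y -> yb X = yb Y -> yt X = yt Y -> X = Y.
Proof. destruct X, Y; simpl; intros; subst; reflexivity. Qed.

(* [Z] sharing the right side of [X] cannot start strictly to the right of [xl X]
   and carry a left contact point below [X]: the bottom of [X] would then meet a
   rectangle [W] squeezed between [xl X] and [xl Z], whose left contact point must
   lie above [X], so that [W] would cross [Y]. *)
Lemma no_overhang_below (G H : list rectangle) (X Y Z : rectangle) (y1 y2 y3 : R) :
  disjoint_family G -> disjoint_family H -> sides_touch G H -> sides_touch H G ->
  In X G -> In Y H -> In Z H ->
  (forall W, In W H -> (exists x y, in_rect X x y /\ in_rect W x y) ->
     xl X <= xl W /\ (xl W = xl X -> xr X <= xr W)) ->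
  in_rect X (xl X) y1 -> in_rect Y (xl X) y1 -> xl Y = xl X ->
  in_rect X (xr X) y2 -> in_rect Z (xr X) y2 -> xr Z = xr X ->
  xl X < xl Z -> in_rect Z (xl Z) y3 -> y3 < yb X -> False.
Proof.
  intros DG DH SGH SHG HX HY HZ Hmin X1 Y1 EY X2 Z2 EZ Hlt Z3 Hy3.
  destruct (SGH X HX) as [_ [_ [[W [x4 [HW [X4 [W4 EW]]]]] _]]].
  assert (MW := Hmin W HW (ex_intro _ x4 (ex_intro _ _ (conj X4 W4)))).
  assert (MY := Hmin Y HY (ex_intro _ _ (ex_intro _ _ (conj X1 Y1)))).
  assert (WZ : W <> Z) by (intros ->; unfold in_rect in *; lra).
  assert (L4 : x4 < xl Z).
  { apply Rnot_le_lt; intros L. apply WZ, (DH W Z x4 (yb X)); auto.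
    unfold in_rect in *; lra. }
  assert (LW : xr W < xl Z).
  { apply Rnot_le_lt; intros L. apply WZ, (DH W Z (xl Z) (yb X)); auto;
    unfold in_rect in *; lra. }
  (* If [W] started level with [X], minimality would make it reach [xr X], yet it ends before
     [xl Z]. *)
  assert (LX : xl X < xl W).
  { destruct MW as [[L|E] M]; [exact L|]. symmetry in E. specialize (M E).
    unfold in_rect in *; lra. }
  destruct (SHG W HW) as [[X' [y5 [HX' [W5 [X5 EX']]]]] _].
  assert (L5 : yt X < y5).
  { apply Rnot_le_lt; intros L.
    assert (X = X') as <-; [|lra].
    apply (DG X X' (xl W) y5); auto; unfold in_rect in *; lra. }
  (* By minimality [Y] reaches at least to [xr X], and [W] spans the height [y1]; so both contain
     the point at abscissa [xl W] and height [y1]. *)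
  assert (W = Y) as ->; [|lra].
  apply (DH W Y (xl W) y1); auto; unfold in_rect in *; lra.
Qed.

(** The right contact [Z] turns out to be [X] itself. If [Z] started strictly further right, its
    left contact point would lie below [X], above [X] or beside it: the first two are overhangs, and
    in the third case the rectangle of [G] touched there would meet [X]. Once the horizontal extents
    agree, a discrepancy at bottom or top would put a horizontal side of one rectangle across the
    other, and the rectangle touching that side would violate disjointness. *)
Lemma lex_min_rectangle_common (G H : list rectangle) (X : rectangle) :
  disjoint_family G -> disjoint_family H -> sides_touch G H -> sides_touch H G ->
  In X G ->
  (forall W, In W H -> (exists x y, in_rect X x y /\ in_rect W x y) ->
     xl X <= xl W /\ (xl W = xl X -> xr X <= xr W)) ->
  In X H.
Proof.
  intros DG DH SGH SHG HX Hmin.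
  destruct (SGH X HX) as [[Y [y1 [HY [X1 [Y1 EY]]]]] [[Z [y2 [HZ [X2 [Z2 EZ]]]]]
    [[B [x3 [HB [X3 [B3 EB]]]]] [T [x4 [HT [X4 [T4 ET]]]]]]]].
  assert (MZ := Hmin Z HZ (ex_intro _ _ (ex_intro _ _ (conj X2 Z2)))).
  destruct (SHG Z HZ) as [[X' [y5 [HX' [Z5 [X5 EX']]]]] [_
    [[B' [x6 [HB' [Z6 [B6 EB']]]]] [T' [x7 [HT' [Z7 [T7 ET']]]]]]]].
  assert (El : xl Z = xl X).
  { destruct MZ as [[L|E] _]; [exfalso|lra].
    destruct (Rlt_or_le y5 (yb X)) as [L5|L5];
      [now apply (no_overhang_below G H X Y Z y1 y2 y5)|].
    destruct (Rlt_or_le (yt X) y5) as [L6|L6].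
    - apply (no_overhang_below (map flip_rect G) (map flip_rect H)
        (flip_rect X) (flip_rect Y) (flip_rect Z) (- y1) (- y2) (- y5));
        auto using disjoint_family_flip, sides_touch_flip, in_map;
        try (unfold in_rect in *; simpl in *; lra).
      intros W HW [x [y [A1 A2]]]. apply in_map_iff in HW as [W0 [<- HW]].
      apply (Hmin W0 HW). exists x, (- y).
      unfold in_rect in *; simpl in *; lra.
    - assert (X = X') as <-; [|lra].
      apply (DG X X' (xl Z) y5); auto; unfold in_rect in *; lra. }
  assert (X = Z) as ->; [|exact HZ].
  apply rectangle_ext; try lra.
  - destruct (Rtotal_order (yb X) (yb Z)) as [L|[E|L]]; [exfalso|exact E|exfalso].
    + assert (X = B') as <-; [|lra].
      apply (DG X B' x6 (yb Z)); auto; unfold in_rect in *; lra.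
    + assert (Z = B) as <-; [|lra].
      apply (DH Z B x3 (yb X)); auto; unfold in_rect in *; lra.
  - destruct (Rtotal_order (yt X) (yt Z)) as [L|[E|L]]; [exfalso|exact E|exfalso].
    + assert (Z = T) as <-; [|lra].
      apply (DH Z T x4 (yt X)); auto; unfold in_rect in *; lra.
    + assert (X = T') as <-; [|lra].
      apply (DG X T' x7 (yt Z)); auto; unfold in_rect in *; lra.
Qed.

(** Minimising over the uncommon rectangles of both families together suffices: a common rectangle
    meeting [X] belongs to the family of [X], hence equals [X], which is not common. So every
    rectangle of the other family that meets [X] takes part in the comparison. *)
Lemma touching_families_incl (G H : list rectangle) :
  disjoint_family G -> disjoint_family H -> sides_touch G H -> sides_touch H G ->
  incl G H.
Proof.
  intros DG DH SGH SHG X0 HX0. apply NNPP; intros HnX0.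
  pose (bad X := ~ (In X G /\ In X H)).
  destruct (finite_argmin (G ++ H) xl bad) as [X1 [I1 [B1 M1]]].
  { exists X0. split; [apply in_or_app; now left|]. unfold bad; tauto. }
  (* A second minimisation among those with least left end yields the lexicographic minimum. *)
  destruct (finite_argmin (G ++ H) xr (fun X => bad X /\ xl X = xl X1))
    as [X [I [[B E] M]]]; [now exists X1|].
  apply B. apply in_app_or in I as [I|I]; split; auto.
  - apply (lex_min_rectangle_common G H); auto. intros W HW [x [y [HXx HWx]]].
    assert (BW : bad W).
    { intros [HWG _]. apply B. assert (X = W) as -> by eauto. tauto. }
    assert (I' : In W (G ++ H)) by (apply in_or_app; now right).
    specialize (M1 W I' BW). split; [lra|]. intros. apply M; auto. split; auto; lra.
  - apply (lex_min_rectangle_common H G); auto. intros W HW [x [y [HXx HWx]]].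
    assert (BW : bad W).
    { intros [_ HWH]. apply B. assert (X = W) as -> by eauto. tauto. }
    assert (I' : In W (G ++ H)) by (apply in_or_app; now left).
    specialize (M1 W I' BW). split; [lra|]. intros. apply M; auto. split; auto; lra.
Qed.

(** * Euclidean space *)

Lemma pt_ext (p q : pt) : (forall k, (k < 3)%nat -> coord p k = coord q k) -> p = q.
Proof.
  destruct p, q. intros E. f_equal;
  [apply (E 0%nat)|apply (E 1%nat)|apply (E 2%nat)]; lia.
Qed.

Definition norm (v : pt) : R := sqrt (dot v v).

Lemma dot_self_ge0 (v : pt) : 0 <= dot v v.
Proof. unfold dot; nra. Qed.

Lemma dot_self_gt0 (v : pt) : v <> mkpt 0 0 0 -> 0 < dot v v.
Proof.
  intros Hv. destruct (dot_self_ge0 v) as [L|E]; [exact L|]. exfalso; apply Hv.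
  destruct v as [a b c]; unfold dot in E; simpl in E.
  f_equal; nra.
Qed.

Lemma norm_ge0 (v : pt) : 0 <= norm v.
Proof. apply sqrt_pos. Qed.

Lemma norm_sq (v : pt) : norm v * norm v = dot v v.
Proof. apply sqrt_sqrt, dot_self_ge0. Qed.

Lemma dot_le_norm (u v : pt) : dot u v <= norm u * norm v.
Proof.
  destruct (Rle_or_lt (dot u v) 0) as [L|L].
  - pose proof (norm_ge0 u); pose proof (norm_ge0 v); nra.
  - apply Rsqr_incr_0_var.
    + unfold Rsqr.
      replace (norm u * norm v * (norm u * norm v))
        with ((norm u * norm u) * (norm v * norm v)) by ring.
      rewrite !norm_sq. destruct u as [a b c], v as [a' b' c']. unfold dot; simpl.
      (* Lagrange's identity: these three squares sum to the Cauchy-Schwarz defect. *)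
      pose proof (Rle_0_sqr (a * b' - b * a')) as S1.
      pose proof (Rle_0_sqr (a * c' - c * a')) as S2.
      pose proof (Rle_0_sqr (b * c' - c * b')) as S3. unfold Rsqr in *. lra.
    + apply Rmult_le_pos; apply norm_ge0.
Qed.

Lemma norm_add (u v : pt) : norm (vadd u v) <= norm u + norm v.
Proof.
  apply Rsqr_incr_0_var.
  - unfold Rsqr. rewrite norm_sq.
    replace (dot (vadd u v) (vadd u v)) with (dot u u + 2 * dot u v + dot v v)
      by (unfold dot; simpl; ring).
    pose proof (dot_le_norm u v). rewrite <- !norm_sq. lra.
  - pose proof (norm_ge0 u); pose proof (norm_ge0 v); lra.
Qed.

Lemma norm_scale (t : R) (v : pt) : norm (vscale t v) = Rabs t * norm v.
Proof.
  unfold norm. replace (dot (vscale t v) (vscale t v)) with (t² * dot v v)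
    by (unfold dot, Rsqr; simpl; ring).
  rewrite sqrt_mult; [|apply Rle_0_sqr|apply dot_self_ge0]. now rewrite sqrt_Rsqr_abs.
Qed.

Lemma dist_norm (p q : pt) : dist p q = norm (vsub p q).
Proof. reflexivity. Qed.

Lemma dist_sym (p q : pt) : dist p q = dist q p.
Proof. unfold dist. f_equal. unfold dot; simpl; ring. Qed.

Lemma dist_refl (p : pt) : dist p p = 0.
Proof.
  unfold dist. replace (dot (vsub p p) (vsub p p)) with 0 by (unfold dot; simpl; ring).
  apply sqrt_0.
Qed.

Lemma dist_tri (p q r : pt) : dist p r <= dist p q + dist q r.
Proof.
  rewrite !dist_norm. replace (vsub p r) with (vadd (vsub p q) (vsub q r));
    [apply norm_add|].
  destruct p, q, r; unfold vsub, vadd, vscale; simpl; f_equal; ring.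
Qed.

Lemma coord_dist (p q : pt) (k : nat) : Rabs (coord p k - coord q k) <= dist p q.
Proof.
  rewrite <- sqrt_Rsqr_abs. apply sqrt_le_1_alt. unfold Rsqr, dot.
  pose proof (Rle_0_sqr (px p - px q)) as Sx. pose proof (Rle_0_sqr (py p - py q)) as Sy.
  pose proof (Rle_0_sqr (pz p - pz q)) as Sz. unfold Rsqr in *.
  destruct k as [|[|k]]; simpl; lra.
Qed.

Lemma coord_close (p q : pt) (k : nat) (e : R) :
  dist p q < e -> coord p k - e < coord q k < coord p k + e.
Proof.
  intros D. pose proof (coord_dist p q k) as C.
  assert (A : Rabs (coord p k - coord q k) < e) by lra.
  apply Rabs_def2 in A. lra.
Qed.

Definition shift (p : pt) (t : R) (v : pt) : pt := vadd p (vscale t v).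

Lemma dot_shift (n p : pt) (t : R) (v : pt) :
  dot n (shift p t v) = dot n p + t * dot n v.
Proof. unfold dot; simpl; ring. Qed.

Lemma dist_shift2 (p : pt) (s t : R) (v : pt) :
  dist (shift p s v) (shift p t v) = Rabs (s - t) * norm v.
Proof.
  rewrite dist_norm, <- norm_scale. f_equal.
  unfold shift, vsub, vadd, vscale; simpl; f_equal; ring.
Qed.

Lemma small_shift (v : pt) (e : R) : 0 < e ->
  exists t0, 0 < t0 /\ forall s t p, Rabs (s - t) < t0 ->
    dist (shift p s v) (shift p t v) < e.
Proof.
  intros He. pose proof (norm_ge0 v) as N.
  (* The added 1 keeps the denominator positive when [v] vanishes. *)
  exists (e / (norm v + 1)). assert (0 < e / (norm v + 1)) by (apply Rdiv_lt_0_compat; lra).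
  split; [assumption|]. intros s t p Ht. rewrite dist_shift2.
  apply Rle_lt_trans with (e / (norm v + 1) * norm v).
  - apply Rmult_le_compat_r; lra.
  - apply Rlt_le_trans with (e / (norm v + 1) * (norm v + 1)).
    + apply Rmult_lt_compat_l; lra.
    + right; field; lra.
Qed.

Lemma shift0 (p v : pt) : shift p 0 v = p.
Proof. destruct p; unfold shift, vadd, vscale; simpl; f_equal; ring. Qed.

Lemma shift1 (p q : pt) : shift p 1 (vsub q p) = q.
Proof. destruct p, q; unfold shift, vsub, vadd, vscale; simpl; f_equal; ring. Qed.

Lemma exists_small_shift (p v : pt) (e : R) : 0 < e ->
  exists t0, 0 < t0 /\ forall t, Rabs t < t0 -> dist p (shift p t v) < e.
Proof.
  intros He. destruct (small_shift v e He) as [t0 [P0 S]]. exists t0. split; [exact P0|].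
  intros t Ht. rewrite <- (shift0 p v) at 1. apply S.
  rewrite Rminus_0_l, Rabs_Ropp. exact Ht.
Qed.

Lemma dist_segment (y p q : pt) (t e : R) : 0 <= t <= 1 ->
  dist y p < e -> dist y q < e -> dist y (shift p t (vsub q p)) < e.
Proof.
  intros Ht Hp Hq. rewrite dist_norm in *.
  replace (vsub y (shift p t (vsub q p)))
    with (vadd (vscale (1 - t) (vsub y p)) (vscale t (vsub y q)))
    by (destruct y, p, q; unfold shift, vsub, vadd, vscale; simpl; f_equal; ring).
  eapply Rle_lt_trans; [apply norm_add|]. rewrite !norm_scale.
  (* One of the weights [t] and [1 - t] is at least one half, so the strict bound survives in the
     convex combination. *)
  rewrite !Rabs_pos_eq by lra. destruct (Rle_or_lt t (1 / 2)); nra.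
Qed.

(** * Crossing points and connected sets *)

(** The crossing parameter is the supremum of the initial intervals on which [A] holds. *)
Lemma interval_crossing (A : R -> Prop) : A 0 -> ~ A 1 ->
  exists t, 0 <= t <= 1 /\ forall e, 0 < e ->
    (exists s, 0 <= s <= 1 /\ Rabs (t - s) < e /\ A s) /\
    (exists s, 0 <= s <= 1 /\ Rabs (t - s) < e /\ ~ A s).
Proof.
  intros A0 A1.
  pose (E := fun t => 0 <= t <= 1 /\ forall s, 0 <= s <= t -> A s).
  assert (E0 : E 0).
  { split; [lra|]. intros s Hs. replace s with 0 by lra. exact A0. }
  destruct (completeness E) as [t [Hub Hlub]].
  - exists 1. intros x [Hx _]. lra.
  - now exists 0.
  - assert (T0 : 0 <= t) by now apply Hub.
    assert (T1 : t <= 1) by (apply Hlub; intros x [Hx _]; lra).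
    exists t. split; [lra|]. intros e He. split.
    + apply NNPP; intros Hn.
      assert (t <= t - e); [|lra].
      apply Hlub. intros x [Hx HA]. apply Rnot_lt_le. intros Hlt.
      apply Hn. exists x. split; [lra|]. split.
      * assert (x <= t) by (apply Hub; split; auto). apply Rabs_def1; lra.
      * apply HA; lra.
    + apply NNPP; intros Hn.
      assert (HA : forall s, 0 <= s <= 1 -> Rabs (t - s) < e -> A s)
        by (intros s Hs He'; apply NNPP; intros Ha; apply Hn; eauto).
      (* Without failures of [A] near [t], an initial interval would extend past [t], either up to 1
         or beyond the supremum. *)
      assert (HE : forall u, 0 <= u <= 1 -> u < t + e -> E u).
      { intros u Hu Hue. split; [lra|]. intros s Hs.
        destruct (Rlt_or_le (t - e) s) as [L|L].
        - apply HA; [lra|]. apply Rabs_def1; lra.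
        - apply NNPP; intros Ha.
          assert (t <= s); [|lra].
          apply Hlub. intros x [Hx HxA]. apply Rnot_lt_le; intros Lx.
          apply Ha, HxA; lra. }
      destruct (Rlt_or_le 1 (t + e)) as [L|L].
      * apply A1. apply (HE 1); lra.
      * assert (t + e / 2 <= t); [|lra]. apply Hub, HE; lra.
Qed.

Lemma segment_crosses_boundary (P : pset) (p q : pt) : P p -> ~ P q ->
  exists t, 0 <= t <= 1 /\ boundary P (shift p t (vsub q p)).
Proof.
  intros Hp Hq.
  destruct (interval_crossing (fun t => P (shift p t (vsub q p)))) as [t [Ht C]].
  - now rewrite shift0.
  - now rewrite shift1.
  - exists t. split; [exact Ht|]. intros e He.
    destruct (small_shift (vsub q p) e He) as [t0 [P0 S]].
    destruct (C t0 P0) as [[s [_ [D1 A1]]] [s' [_ [D2 A2]]]].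
    split; eexists; (split; [eassumption|]); apply S; assumption.
Qed.

Definition segment (p q : pt) : pset :=
  fun z => exists t, 0 <= t <= 1 /\ z = shift p t (vsub q p).

(** A separation is pulled back to the stretch between a point of [U] and a point of [V]. At a
    crossing parameter, membership in [U] both holds and fails arbitrarily near, against the
    openness of whichever set contains that point. *)
Lemma segment_connected (p q : pt) : connected (segment p q).
Proof.
  intros [U [V [OU [OV [Cov [Dis [[x [Sx Ux]] [y [Sy Vy]]]]]]]]].
  destruct Sx as [a [Ha ->]], Sy as [b [Hb ->]].
  pose (f := fun t => shift p (a + t * (b - a)) (vsub q p)).
  assert (Sf : forall t, 0 <= t <= 1 -> segment p q (f t)).
  { intros t Ht. exists (a + t * (b - a)). split; [nra|reflexivity]. }
  assert (Cf : forall e, 0 < e -> exists d, 0 < d /\ forall s t,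
             Rabs (s - t) < d -> dist (f s) (f t) < e).
  { intros e He. destruct (small_shift (vsub q p) e He) as [t0 [P0 S]].
    exists t0. split; [exact P0|]. intros s t Hst. apply S.
    replace (a + s * (b - a) - (a + t * (b - a))) with ((s - t) * (b - a)) by ring.
    rewrite Rabs_mult. assert (Rabs (b - a) <= 1) by (apply Rabs_le; lra).
    pose proof (Rabs_pos (s - t)). nra. }
  assert (f0 : f 0 = shift p a (vsub q p)) by (unfold f; f_equal; ring).
  assert (f1 : f 1 = shift p b (vsub q p)) by (unfold f; f_equal; ring).
  destruct (interval_crossing (fun t => U (f t))) as [t [Ht C]].
  - now rewrite f0.
  - rewrite f1. intros Ub. apply (Dis (shift p b (vsub q p))); auto. now exists b.
  - destruct (Cov _ (Sf t Ht)) as [Ut|Vt].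
    + destruct (OU _ Ut) as [e [He B]]. destruct (Cf e He) as [d [Hd D]].
      destruct (C d Hd) as [_ [s [Hs [Ds Ns]]]]. apply Ns, B, D, Ds.
    + destruct (OV _ Vt) as [e [He B]]. destruct (Cf e He) as [d [Hd D]].
      destruct (C d Hd) as [[s [Hs [Ds Us]]] _].
      apply (Dis (f s)); auto.
Qed.

Lemma connected_union (A B : pset) (z : pt) :
  connected A -> connected B -> A z -> B z -> connected (fun x => A x \/ B x).
Proof.
  intros CA CB Az Bz [U [V [OU [OV [Cov [Dis [[x [Sx Ux]] [y [Sy Vy]]]]]]]]].
  assert (HA : ~ ((exists x, A x /\ U x) /\ (exists x, A x /\ V x))).
  { intros [E1 E2]. apply CA. exists U, V. repeat split; auto; intros; eauto. }
  assert (HB : ~ ((exists x, B x /\ U x) /\ (exists x, B x /\ V x))).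
  { intros [E1 E2]. apply CB. exists U, V. repeat split; auto; intros; eauto. }
  destruct (Cov z (or_introl Az)) as [Uz|Vz];
    destruct Sx as [Sx|Sx], Sy as [Sy|Sy];
    solve [apply HA; split; [exists x|exists y]; auto | apply HA; split; [exists z|exists y]; auto
          |apply HA; split; [exists x|exists z]; auto | apply HB; split; [exists x|exists y]; auto
          |apply HB; split; [exists z|exists y]; auto | apply HB; split; [exists x|exists z]; auto].
Qed.

(** * Oriented flat points *)

(** Literally the local clause of [outward_normal], so the witness point there is one of these.
    Points of the plane itself are left unspecified. *)
Definition half_space_at (P : pset) (n y : pt) : Prop :=
  exists e, 0 < e /\ forall z, dist y z < e ->
    (dot n z < dot n y -> P z) /\ (dot n y < dot n z -> ~ P z).

Definition is_closed (P : pset) : Prop :=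
  forall x, ~ P x -> exists e, 0 < e /\ forall y, dist x y < e -> ~ P y.

(* A weak form of "P is the closure of its interior". *)
Definition thick (P : pset) : Prop :=
  forall x n c e, P x -> n <> mkpt 0 0 0 -> 0 < e ->
    exists y, P y /\ dist x y < e /\ dot n y <> c.

Lemma half_space_boundary (P : pset) (n y : pt) :
  n <> mkpt 0 0 0 -> half_space_at P n y -> boundary P y.
Proof.
  intros Hn [e [He H]] d Hd. pose proof (dot_self_gt0 n Hn) as N.
  destruct (exists_small_shift y n (Rmin d e)) as [t0 [P0 S]];
    [now apply Rmin_glb_lt|].
  assert (forall t, Rabs t < t0 -> dist y (shift y t n) < d /\ dist y (shift y t n) < e)
    as S'.
  { intros t Ht. specialize (S t Ht). pose proof (Rmin_l d e); pose proof (Rmin_r d e); lra. }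
  destruct (S' (t0 / 2)) as [D1 E1]; [apply Rabs_def1; lra|].
  destruct (S' (- (t0 / 2))) as [D2 E2]; [apply Rabs_def1; lra|].
  split.
  - exists (shift y (- (t0 / 2)) n). split; [|exact D2].
    apply (H _ E2). rewrite dot_shift. nra.
  - exists (shift y (t0 / 2) n). split; [|exact D1].
    apply (H _ E1). rewrite dot_shift. nra.
Qed.

Lemma half_space_move (P : pset) (n y : pt) :
  half_space_at P n y -> exists e, 0 < e /\
    forall z, dist y z < e -> dot n z = dot n y -> half_space_at P n z.
Proof.
  intros [e [He H]]. exists (e / 2). split; [lra|]. intros z Hz E.
  exists (e / 2). split; [lra|]. intros w Hw. rewrite E. apply H.
  pose proof (dist_tri y z w). lra.
Qed.

Lemma dot_continuous (n z : pt) (g : R) : 0 < g ->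
  exists d, 0 < d /\ forall w, dist z w < d -> Rabs (dot n w - dot n z) < g.
Proof.
  intros Hg. pose proof (norm_ge0 n) as N. exists (g / (norm n + 1)).
  split; [apply Rdiv_lt_0_compat; lra|]. intros w Hw.
  assert (D1 := dot_le_norm n (vsub w z)). assert (D2 := dot_le_norm n (vsub z w)).
  rewrite <- dist_norm in D1, D2. rewrite (dist_sym w z) in D1.
  assert (dot n (vsub w z) = dot n w - dot n z) by (unfold dot; simpl; ring).
  assert (dot n (vsub z w) = dot n z - dot n w) by (unfold dot; simpl; ring).
  assert (0 <= dist z w) by apply norm_ge0.
  assert (dist z w * (norm n + 1) < g).
  { apply Rlt_le_trans with (g / (norm n + 1) * (norm n + 1)).
    - apply Rmult_lt_compat_r; lra.
    - right; field; lra. }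
  apply Rabs_def1; nra.
Qed.

(** A point near [y] but off the plane has a small ball strictly on one side, where [P] is
    everything or nothing; so it is no boundary point. *)
Lemma half_space_flat (P : pset) (n y : pt) :
  n <> mkpt 0 0 0 -> half_space_at P n y -> flat_points P y.
Proof.
  intros Hn HS. split; [now apply half_space_boundary with n|].
  destruct HS as [e [He H]]. exists e, n, (dot n y).
  split; [exact He|]. split; [exact Hn|]. intros z Dz Bz. unfold in_plane.
  destruct (Req_dec_T (dot n z) (dot n y)) as [E|Hne]; [exact E|exfalso].
  pose (g := Rabs (dot n z - dot n y)).
  assert (Hg : 0 < g) by (apply Rabs_pos_lt; lra).
  destruct (dot_continuous n z g Hg) as [d [Hd D]].
  destruct (Bz (Rmin d (e - dist y z))) as [[p [Pp Dp]] [q [Nq Dq]]];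
    [apply Rmin_glb_lt; lra|].
  pose proof (Rmin_l d (e - dist y z)). pose proof (Rmin_r d (e - dist y z)).
  pose proof (dist_tri y z p). pose proof (dist_tri y z q).
  destruct (H p ltac:(lra)) as [_ Hp], (H q ltac:(lra)) as [Hq _].
  specialize (D p ltac:(lra)) as Ep. specialize (D q ltac:(lra)) as Eq.
  apply Rabs_def2 in Ep, Eq. unfold g in *.
  destruct (Rlt_or_le (dot n z) (dot n y)) as [L|L].
  - rewrite (Rabs_left (dot n z - dot n y)) in Eq by lra. apply Nq, Hq. lra.
  - rewrite (Rabs_pos_eq (dot n z - dot n y)) in Ep by lra. apply Hp; [lra|exact Pp].
Qed.

Lemma half_space_not_opposite (P : pset) (n y : pt) :
  n <> mkpt 0 0 0 -> half_space_at P n y -> half_space_at P (vscale (-1) n) y -> False.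
Proof.
  intros Hn [e [He H]] [e' [He' H']]. pose proof (dot_self_gt0 n Hn) as N.
  destruct (exists_small_shift y n (Rmin e e')) as [t0 [P0 S]];
    [now apply Rmin_glb_lt|].
  specialize (S (t0 / 2) ltac:(apply Rabs_def1; lra)).
  pose proof (Rmin_l e e'); pose proof (Rmin_r e e').
  apply (proj2 (H (shift y (t0 / 2) n) ltac:(lra))); [rewrite dot_shift; nra|].
  apply (proj1 (H' (shift y (t0 / 2) n) ltac:(lra))).
  assert (Eo : forall u, dot (vscale (-1) n) u = - dot n u) by (intros; unfold dot; simpl; ring).
  rewrite !Eo, dot_shift. nra.
Qed.

(** For distinct unit vectors, a small step along [n - m] increases [dot n] and decreases [dot m],
    so it would both leave [P] and stay in it. *)
Lemma half_space_unit_normal_unique (P : pset) (n m y : pt) :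
  dot n n = 1 -> dot m m = 1 -> half_space_at P n y -> half_space_at P m y -> n = m.
Proof.
  intros Hn Hm [e [He H]] [e' [He' H']]. apply NNPP; intros Hne.
  assert (0 < dot (vsub n m) (vsub n m)) as L.
  { apply dot_self_gt0. intros E. apply Hne. injection E as E1 E2 E3.
    destruct n, m; simpl in *; f_equal; lra. }
  assert (E : dot (vsub n m) (vsub n m) = dot n n - 2 * dot n m + dot m m)
    by (unfold dot; simpl; ring).
  destruct (exists_small_shift y (vsub n m) (Rmin e e')) as [t0 [P0 S]];
    [now apply Rmin_glb_lt|].
  specialize (S (t0 / 2) ltac:(apply Rabs_def1; lra)).
  pose proof (Rmin_l e e'); pose proof (Rmin_r e e').
  assert (E1 : dot n (vsub n m) = dot n n - dot n m) by (unfold dot; simpl; ring).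
  assert (E2 : dot m (vsub n m) = dot n m - dot m m) by (unfold dot; simpl; ring).
  apply (proj2 (H (shift y (t0 / 2) (vsub n m)) ltac:(lra))).
  - rewrite dot_shift. nra.
  - apply (proj1 (H' (shift y (t0 / 2) (vsub n m)) ltac:(lra))). rewrite dot_shift. nra.
Qed.

Lemma half_space_scale (P : pset) (n m y : pt) (c : R) :
  0 < c -> (forall z, dot n z = c * dot m z) -> half_space_at P n y -> half_space_at P m y.
Proof.
  intros Hc E [e [He H]]. exists e. split; [exact He|]. intros z Hz.
  specialize (H z Hz). rewrite !E in H. destruct H as [H1 H2].
  split; intros L; [apply H1|apply H2]; apply Rmult_lt_compat_l; assumption.
Qed.

(** A segment joining two points strictly on one side avoids the plane, while a change of membership
    along it would produce a boundary point, which must lie in the plane. *)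
Lemma side_uniform (P : pset) (n y p q : pt) (e c : R) :
  (forall z, dist y z < e -> boundary P z -> dot n z = c) ->
  dist y p < e -> dist y q < e ->
  (dot n p < c /\ dot n q < c) \/ (c < dot n p /\ c < dot n q) -> P p -> P q.
Proof.
  intros Hb Dp Dq Side Pp. apply NNPP; intros Nq.
  destruct (segment_crosses_boundary P p q Pp Nq) as [t [Ht Bt]].
  specialize (Hb _ (dist_segment y p q t e Ht Dp Dq) Bt).
  rewrite dot_shift in Hb.
  replace (dot n (vsub q p)) with (dot n q - dot n p) in Hb by (unfold dot; simpl; ring).
  destruct Side as [[L1 L2]|[L1 L2]]; destruct (Rle_or_lt t (1/2)); nra.
Qed.

(** Near a flat point [P] is constant on each open side of the plane. Thickness excludes a thin
    sheet and closedness a slit: they give a point of [P] and a point of the complement, both off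
    the plane. These cannot share a side, so exactly one side is filled. *)
Lemma flat_half_space (P : pset) (y : pt) : is_closed P -> thick P -> flat_points P y ->
  exists n, n <> mkpt 0 0 0 /\ half_space_at P n y.
Proof.
  intros CP TP [By [e [n [c [He [Hn Hp]]]]]]. unfold in_plane in Hp.
  assert (Ey : dot n y = c) by (apply Hp; auto; now rewrite dist_refl).
  destruct (By (e / 2)) as [[p0 [Pp0 Dp0]] [q0 [Nq0 Dq0]]]; [lra|].
  destruct (TP p0 n c (e / 2) Pp0 Hn) as [p [Pp [Dp Np]]]; [lra|].
  assert (Dyp : dist y p < e) by (pose proof (dist_tri y p0 p); lra).
  assert (exists q, ~ P q /\ dist y q < e /\ dot n q <> c) as [q [Nq [Dyq Hq]]].
  (* A complement point lying in the plane is pushed off it inside a ball that misses [P]. *)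
  { destruct (CP q0 Nq0) as [d [Hd D]].
    destruct (exists_small_shift q0 n (Rmin d (e / 2))) as [t0 [P0 S]];
      [apply Rmin_glb_lt; lra|].
    specialize (S (t0 / 2) ltac:(apply Rabs_def1; lra)).
    pose proof (Rmin_l d (e / 2)); pose proof (Rmin_r d (e / 2)).
    pose proof (dot_self_gt0 n Hn).
    destruct (Req_dec_T (dot n q0) c) as [E|E]; [|exists q0; repeat split; auto; lra].
    exists (shift q0 (t0 / 2) n). split; [apply D; lra|]. split.
    - pose proof (dist_tri y q0 (shift q0 (t0 / 2) n)). lra.
    - rewrite dot_shift. nra. }
  assert (Op : (dot n p < c /\ c < dot n q) \/ (c < dot n p /\ dot n q < c)).
  { destruct (Rtotal_order (dot n p) c) as [L1|[E1|L1]];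
    destruct (Rtotal_order (dot n q) c) as [L2|[E2|L2]]; try tauto;
    exfalso; apply Nq, (side_uniform P n y p q e c); auto. }
  assert (Sp := fun z Dz S => side_uniform P n y p z e c Hp Dyp Dz S Pp).
  assert (Sq := fun z Dz S Pz => Nq (side_uniform P n y z q e c Hp Dz Dyq S Pz)).
  destruct Op as [[L1 L2]|[L1 L2]].
  - exists n. split; [exact Hn|]. exists e. split; [exact He|]. rewrite Ey.
    intros z Dz. split; intros L; [apply Sp; auto|intros Pz; apply (Sq z); auto].
  - exists (vscale (-1) n).
    assert (Eo : forall u, dot (vscale (-1) n) u = - dot n u)
      by (intros; unfold dot; simpl; ring).
    split.
    + intros E. apply Hn. injection E as E1 E2 E3. destruct n; simpl in *; f_equal; lra.
    + exists e. split; [exact He|]. intros z Dz. rewrite !Eo, Ey.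
      split; intros L; [apply Sp; auto; lra|intros Pz; apply (Sq z); auto; lra].
Qed.

(** * Orientation along the components of flat points *)

Lemma component_sub (A : pset) (p y : pt) : component A p y -> A y.
Proof. intros [C [HC [_ [_ Cy]]]]. auto. Qed.

Lemma closure_sub (A : pset) (y : pt) : A y -> closure A y.
Proof. intros Ay e He. exists y. split; [exact Ay|]. now rewrite dist_refl. Qed.

(* A small disc around [y] in its plane is flat, hence lies in the component. *)
Lemma component_normal (P : pset) (p y n m : pt) (c : R) :
  dot n n = 1 -> (forall z, component (flat_points P) p z -> dot n z = c) ->
  component (flat_points P) p y -> m <> mkpt 0 0 0 -> half_space_at P m y ->
  half_space_at P n y \/ half_space_at P (vscale (-1) n) y.
Proof.
  intros Hn Hc Cy Hm HS. pose proof (dot_self_gt0 m Hm) as M.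
  (* Orthogonal projection of [n] on [m]: once the remainder [w] is shown to vanish, [n] is [a]
     times [m] and the sign of [a] decides the orientation. *)
  pose (a := dot n m / dot m m).
  pose (w := vsub n (vscale a m)).
  assert (Wm : dot m w = 0).
  { replace (dot m w) with (dot n m - a * dot m m) by (unfold w, dot; simpl; ring).
    unfold a; field; lra. }
  assert (Wn : dot n w = 0).
  { destruct (half_space_move P m y HS) as [e [He H]].
    destruct (exists_small_shift y w e He) as [t0 [P0 S]].
    destruct Cy as [C [CF [CC [Cp Cy]]]].
    assert (Cz : component (flat_points P) p (shift y (t0 / 2) w)).
    { exists (fun x => C x \/ segment y (shift y (t0 / 2) w) x).
      assert (Sy : segment y (shift y (t0 / 2) w) y)
        by (exists 0; split; [lra|]; now rewrite shift0).
      assert (Sz : segment y (shift y (t0 / 2) w) (shift y (t0 / 2) w))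
        by (exists 1; split; [lra|]; now rewrite shift1).
      split; [|split; [|auto]].
      - intros z [Iz|[t [Ht ->]]]; [auto|]. apply half_space_flat with m; [exact Hm|].
        replace (shift y t (vsub (shift y (t0 / 2) w) y)) with (shift y (t * (t0 / 2)) w)
          by (unfold shift, vsub, vadd, vscale; simpl; f_equal; ring).
        apply H; [apply S; rewrite Rabs_pos_eq by nra; nra|].
        rewrite dot_shift, Wm. ring.
      - now apply connected_union with y; [|apply segment_connected|..]. }
    assert (E1 := Hc _ Cz). rewrite dot_shift in E1.
    rewrite (Hc y) in E1 by (exists C; auto). nra. }
  assert (W0 : w = mkpt 0 0 0).
  { apply NNPP; intros Hw. apply dot_self_gt0 in Hw.
    replace (dot w w) with (dot n w - a * dot m w) in Hw by (unfold w, dot; simpl; ring).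
    rewrite Wn, Wm in Hw. lra. }
  assert (En : forall z, dot n z = a * dot m z).
  { intros z. assert (E : dot w z = 0) by (rewrite W0; unfold dot; simpl; ring).
    replace (dot w z) with (dot n z - a * dot m z) in E by (unfold w, dot; simpl; ring). lra. }
  assert (Ha : a <> 0) by (intros Ha; rewrite En, Ha in Hn; lra).
  destruct (Rtotal_order a 0) as [L|[E|L]]; [right|contradiction|left].
  - apply (half_space_scale P m _ y (- / a)); auto.
    + assert (/ a < 0) by now apply Rinv_lt_0_compat. lra.
    + intros z. replace (dot (vscale (-1) n) z) with (- dot n z) by (unfold dot; simpl; ring).
      rewrite En. field. exact Ha.
  - apply (half_space_scale P m _ y (/ a)); auto.
    + now apply Rinv_0_lt_compat.
    + intros z. rewrite En. field. exact Ha.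
Qed.

(** The points of [C] oriented by [n] and those oriented by its opposite form disjoint relatively
    open sets, so only one kind occurs. *)
Lemma connected_orientation (P C : pset) (n : pt) (c : R) (p q : pt) :
  n <> mkpt 0 0 0 -> connected C ->
  (forall z, C z -> dot n z = c /\
     (half_space_at P n z \/ half_space_at P (vscale (-1) n) z)) ->
  C p -> C q -> half_space_at P n p -> half_space_at P n q.
Proof.
  intros Hn CC HC Cp Cq Hp. apply NNPP; intros Nq.
  assert (Hq : half_space_at P (vscale (-1) n) q) by (destruct (HC q Cq) as [_ [|]]; tauto).
  (* [connected] speaks of sets open in space, so each orientation is thickened to balls centred in
     the plane all of whose planar points carry it. Disjointness is then checked on [C], which lies
     in that plane. *)
  pose (N := fun m => fun x : pt => exists y e, 0 < e /\ dist y x < e /\ dot n y = c /\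
    forall z, dist y z < e -> dot n z = c -> half_space_at P m z).
  assert (ON : forall m, is_open (N m)).
  { intros m x [y [e [He [Dx [Ey H]]]]]. exists (e - dist y x). split; [lra|].
    intros z Dz. exists y, e. repeat split; auto.
    pose proof (dist_tri y x z). lra. }
  assert (IN : forall m z, (m = n \/ m = vscale (-1) n) -> C z -> half_space_at P m z -> N m z).
  { intros m z Hm Cz Hz. destruct (half_space_move P m z Hz) as [e [He H]].
    assert (Ez := proj1 (HC z Cz)).
    exists z, e. rewrite dist_refl. repeat split; auto. intros w Dw Ew.
    apply H; auto. destruct Hm as [->| ->]; [congruence|].
    replace (dot (vscale (-1) n) w) with (- dot n w) by (unfold dot; simpl; ring).
    replace (dot (vscale (-1) n) z) with (- dot n z) by (unfold dot; simpl; ring).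
    congruence. }
  apply CC. exists (N n), (N (vscale (-1) n)).
  split; [apply ON|]. split; [apply ON|]. split; [|split; [|split]].
  - intros z Cz. destruct (HC z Cz) as [_ [Hz|Hz]]; [left|right]; apply IN; auto.
  - intros z Cz [y [e [_ [D [_ H]]]]] [y' [e' [_ [D' [_ H']]]]].
    assert (Ez := proj1 (HC z Cz)).
    apply (half_space_not_opposite P n z Hn); auto.
  - exists p. split; auto.
  - exists q. split; auto.
Qed.

(** The orientation known at the single point [q] passes to a component point [y1] close to it, from
    there to the base point [p], and then to [y], along the connected sets that witness membership
    in the component. *)
Lemma face_half_space (P F : pset) (p n : pt) :
  is_closed P -> thick P ->
  (forall y, F y <-> closure (component (flat_points P) p) y) ->
  outward_normal P F n ->
  forall y, component (flat_points P) p y -> half_space_at P n y.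
Proof.
  intros CP TP HF [Hn [[c Hc] [q [Fq Hq]]]] y Cy.
  assert (Hn0 : n <> mkpt 0 0 0)
    by (intros ->; unfold dot in Hn; simpl in Hn; lra).
  assert (Hc' : forall z, component (flat_points P) p z -> dot n z = c)
    by (intros z Cz; apply Hc, HF, closure_sub, Cz).
  assert (Or : forall z, component (flat_points P) p z -> dot n z = c /\
     (half_space_at P n z \/ half_space_at P (vscale (-1) n) z)).
  { intros z Cz. split; [auto|].
    destruct (flat_half_space P z CP TP (component_sub _ _ _ Cz)) as [m [Hm HS]].
    now apply component_normal with p m c. }
  assert (Sub : forall C, (forall z, C z -> flat_points P z) -> connected C -> C p ->
    forall z, C z -> component (flat_points P) p z) by (intros C ? ? ? z ?; exists C; auto).
  destruct (half_space_move P n q Hq) as [e [He Hmove]].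
  destruct (proj1 (HF q) Fq e He) as [y1 [Cy1 D1]].
  assert (H1 : half_space_at P n y1)
    by (apply Hmove; [exact D1|]; rewrite (Hc' y1 Cy1), (Hc q Fq); reflexivity).
  destruct Cy1 as [C1 [F1 [CC1 [P1 Y1]]]], Cy as [C2 [F2 [CC2 [P2 Y2]]]].
  apply (connected_orientation P C2 n c p y); auto.
  - intros z Cz. apply Or. eauto.
  - apply (connected_orientation P C1 n c y1 p); auto.
    intros z Cz. apply Or. eauto.
Qed.

(** * Boxes with holes *)

Definition open_box (lo hi : pt) : pset :=
  fun x => forall k, (k < 3)%nat -> coord lo k < coord x k < coord hi k.

Definition hole := (pt * pt)%type.

(* The side of a hole on which the outward normal of the polyhedron is
   [face_normal k s], so that [s = true] selects the lower end of the hole. *)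
Definition side (h : hole) (k : nat) (s : bool) : R :=
  if s then coord (fst h) k else coord (snd h) k.

(* An intrusion is encoded by a closed box which protrudes from the big box by [1]
   through the intruded face, and also through the opposite face when the intrusion
   goes all the way. *)
Record holed_box (P : pset) (lo hi : pt) (i : nat) (L : list hole) : Prop := {
  hb_axis : (i < 3)%nat;
  hb_valid : valid_box lo hi;
  hb_lateral : forall h k, In h L -> (k < 3)%nat -> k <> i ->
    coord lo k < coord (fst h) k /\ coord (fst h) k < coord (snd h) k /\
    coord (snd h) k < coord hi k;
  hb_lower : forall h, In h L ->
    coord (fst h) i = coord lo i - 1 \/ coord lo i < coord (fst h) i < coord hi i;
  hb_upper : forall h, In h L ->
    coord (snd h) i = coord hi i + 1 \/ coord lo i < coord (snd h) i < coord hi i;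
  hb_one_sided :
    (forall h, In h L -> coord (fst h) i = coord lo i - 1) \/
    (forall h, In h L -> coord (snd h) i = coord hi i + 1);
  hb_disjoint : forall h h', In h L -> In h' L -> h = h' \/
    exists k, (k < 3)%nat /\ k <> i /\
      (coord (snd h) k < coord (fst h') k \/ coord (snd h') k < coord (fst h) k);
  hb_closure : forall x, P x <->
    closure (fun y => box lo hi y /\ forall h, In h L -> ~ box (fst h) (snd h) y) x
}.

Lemma face_normal_dot (k : nat) (s : bool) (z : pt) : (k < 3)%nat ->
  dot (face_normal k s) z = if s then coord z k else - coord z k.
Proof.
  intros Hk. destruct k as [|[|[|k]]]; [| | |lia];
    destruct s; unfold dot, face_normal; simpl; ring.
Qed.

Lemma face_normal_unit (k : nat) (s : bool) : dot (face_normal k s) (face_normal k s) = 1.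
Proof. destruct k as [|[|k]], s; unfold dot, face_normal; simpl; ring. Qed.

Lemma face_normal_neq0 (k : nat) (s : bool) : face_normal k s <> mkpt 0 0 0.
Proof.
  intros E. pose proof (face_normal_unit k s) as U. rewrite E in U.
  unfold dot in U; simpl in U; lra.
Qed.

Lemma coord_shift (p v : pt) (t : R) (k : nat) :
  coord (shift p t v) k = coord p k + t * coord v k.
Proof. destruct k as [|[|k]]; reflexivity. Qed.

Lemma coord_face_normal (k l : nat) (s : bool) : (k < 3)%nat -> (l < 3)%nat ->
  coord (face_normal k s) l = if Nat.eqb l k then (if s then 1 else -1) else 0.
Proof.
  intros Hk Hl. destruct k as [|[|[|k]]]; [| | |lia];
  (destruct l as [|[|[|l]]]; [| | |lia]); destruct s; simpl; ring.
Qed.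

Definition mk (f : nat -> R) : pt := mkpt (f 0%nat) (f 1%nat) (f 2%nat).

Lemma coord_mk (f : nat -> R) (k : nat) : (k < 3)%nat -> coord (mk f) k = f k.
Proof. intros Hk. destruct k as [|[|[|k]]]; [reflexivity..|lia]. Qed.

Lemma min_coord (f : nat -> R) : (forall k, (k < 3)%nat -> 0 < f k) ->
  exists e, 0 < e /\ forall k, (k < 3)%nat -> e <= f k.
Proof.
  intros Hf. exists (Rmin (f 0%nat) (Rmin (f 1%nat) (f 2%nat))).
  split.
  - apply Rmin_glb_lt; [apply Hf; lia|apply Rmin_glb_lt; apply Hf; lia].
  - intros k Hk. destruct k as [|[|[|k]]]; [apply Rmin_l| | |lia];
      (eapply Rle_trans; [apply Rmin_r|]); [apply Rmin_l|apply Rmin_r].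
Qed.

Lemma box_not_open (a b x : pt) : box a b x -> ~ open_box a b x ->
  exists k, (k < 3)%nat /\ (coord x k = coord a k \/ coord x k = coord b k).
Proof.
  intros Bx Nx. apply NNPP; intros Hn. apply Nx. intros k Hk.
  specialize (Bx k Hk). assert (coord x k <> coord a k) by eauto 6.
  assert (coord x k <> coord b k) by eauto 6. lra.
Qed.

Lemma not_box_away (a b p : pt) : ~ box a b p ->
  exists e, 0 < e /\ forall z, dist p z < e -> ~ box a b z.
Proof.
  intros N. assert (exists k, (k < 3)%nat /\
    (coord p k < coord a k \/ coord b k < coord p k)) as [k [Hk E]].
  { apply NNPP; intros Hn. apply N. intros k Hk.
    split; apply Rnot_lt_le; intros L; apply Hn; eauto. }
  destruct E as [E|E].
  - exists (coord a k - coord p k). split; [lra|]. intros z Dz Bz.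
    apply coord_close with (k := k) in Dz. specialize (Bz k Hk). lra.
  - exists (coord p k - coord b k). split; [lra|]. intros z Dz Bz.
    apply coord_close with (k := k) in Dz. specialize (Bz k Hk). lra.
Qed.

(** The finitely many closed holes that avoid [p] keep a common positive distance from it. This
    localises the later arguments to the holes through one point. *)
Lemma holes_near (L : list hole) (p : pt) :
  exists e, 0 < e /\ forall z h, dist p z < e -> In h L ->
    box (fst h) (snd h) z -> box (fst h) (snd h) p.
Proof.
  induction L as [|h L [e [He H]]].
  - exists 1. split; [lra|]. intros z h _ [].
  - destruct (classic (box (fst h) (snd h) p)) as [B|N].
    + exists e. split; [exact He|]. intros z h' Dz [<-|I]; eauto.
    + destruct (not_box_away _ _ _ N) as [d [Hd D]].
      exists (Rmin d e). split; [now apply Rmin_glb_lt|].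
      intros z h' Dz [<-|I] Bz; pose proof (Rmin_l d e); pose proof (Rmin_r d e).
      * exfalso. apply (D z); [lra|exact Bz].
      * apply (H z); auto; lra.
Qed.

Lemma closure_box (a b : pt) (A : pset) (p : pt) :
  (forall y, A y -> box a b y) -> closure A p -> box a b p.
Proof.
  intros S C. apply NNPP; intros N. destruct (not_box_away a b p N) as [e [He H]].
  destruct (C e He) as [y [Ay Dy]]. apply (H y Dy). auto.
Qed.

(** Gives a hole-free strip next to the lower lateral faces, in which a test point can be placed on
    any outer face, the intruded one included. *)
Lemma lateral_margin (lo hi : pt) (i : nat) (L : list hole) :
  valid_box lo hi ->
  (forall h k, In h L -> (k < 3)%nat -> k <> i -> coord lo k < coord (fst h) k) ->
  exists d, 0 < d /\ (forall k, (k < 3)%nat -> coord lo k + d < coord hi k) /\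
  forall h k, In h L -> (k < 3)%nat -> k <> i -> coord lo k + d < coord (fst h) k.
Proof.
  intros V. induction L as [|h L' IH]; intros Lat.
  - destruct (min_coord (fun k => (coord hi k - coord lo k) / 2)) as [d [P0 Hd]].
    { intros k Hk. specialize (V k Hk). lra. }
    exists d. split; [exact P0|]. split; [|intros h k []].
    intros k Hk. specialize (Hd k Hk). specialize (V k Hk). simpl in Hd. lra.
  - destruct IH as [d [P0 [D1 D2]]]; [intros h' k' I; apply Lat; now right|].
    (* The value 1 on axis [i] only supplies positivity. *)
    destruct (min_coord (fun k => if Nat.eqb k i then 1 else
      (coord (fst h) k - coord lo k) / 2)) as [d' [P0' Hd]].
    { intros k Hk. destruct (Nat.eqb_spec k i) as [|Hki]; [lra|].
      specialize (Lat h k (or_introl eq_refl) Hk Hki). lra. }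
    exists (Rmin d d'). pose proof (Rmin_l d d'). pose proof (Rmin_r d d').
    split; [now apply Rmin_glb_lt|]. split.
    + intros k Hk. specialize (D1 k Hk). lra.
    + intros h' k [<-|I] Hk Hki.
      * specialize (Hd k Hk). simpl in Hd. specialize (Lat h k (or_introl eq_refl) Hk Hki).
        destruct (Nat.eqb_spec k i); [contradiction|lra].
      * specialize (D2 h' k I Hk Hki). lra.
Qed.

(** * Local structure of a box with holes *)

Section HoledBox.

Variables (P : pset) (lo hi : pt) (i : nat) (L : list hole).
Hypothesis HB : holed_box P lo hi i L.

(** The overshoot is what keeps every side of a hole out of the planes of the box faces, as the last
    two inequalities express; it leaves room in the box for a step out of the hole. *)
Lemma hole_range (h : hole) (k : nat) : In h L -> (k < 3)%nat ->
  coord (fst h) k < coord (snd h) k /\ coord (fst h) k < coord hi k /\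
  coord lo k < coord (snd h) k /\
  coord (fst h) k <> coord lo k /\ coord (snd h) k <> coord hi k.
Proof.
  intros Hh Hk. pose proof (hb_valid _ _ _ _ _ HB k Hk).
  destruct (Nat.eq_dec k i) as [->|Hki].
  - pose proof (hb_lower _ _ _ _ _ HB h Hh). pose proof (hb_upper _ _ _ _ _ HB h Hh).
    destruct (hb_one_sided _ _ _ _ _ HB) as [O|O]; specialize (O h Hh); lra.
  - pose proof (hb_lateral _ _ _ _ _ HB h k Hh Hk Hki). lra.
Qed.

Lemma holes_meet (h h' : hole) (p : pt) : In h L -> In h' L ->
  box (fst h) (snd h) p -> box (fst h') (snd h') p -> h = h'.
Proof.
  intros Hh Hh' B B'. destruct (hb_disjoint _ _ _ _ _ HB h h' Hh Hh') as [E|[k [Hk [_ S]]]];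
    [exact E|]. specialize (B k Hk). specialize (B' k Hk). lra.
Qed.

(** Taking the closure gives back exactly the surfaces of the holes. A point on a hole side is
    approximated by stepping out perpendicularly to that side; other holes do not interfere, since
    the closed holes are pairwise disjoint. *)
Lemma hb_mem (x : pt) :
  P x <-> box lo hi x /\ forall h, In h L -> ~ open_box (fst h) (snd h) x.
Proof.
  rewrite (hb_closure _ _ _ _ _ HB). split.
  - intros C. split.
    + apply (closure_box lo hi _ x) in C; [exact C|]. intros y [By _]; exact By.
    + intros h Hh O.
      pose (d := fun k => Rmin (coord x k - coord (fst h) k) (coord (snd h) k - coord x k)).
      assert (Hd : forall k, (k < 3)%nat -> 0 < d k)
        by (intros k Hk; specialize (O k Hk); apply Rmin_glb_lt; lra).
      destruct (min_coord d Hd) as [e [He Hed]].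
      destruct (C e He) as [y [[_ Ny] Dy]].
      apply (Ny h Hh). intros k Hk.
      assert (Dk : dist x y < d k) by (specialize (Hed k Hk); lra).
      unfold d in Dk. apply coord_close with (k := k) in Dk.
      pose proof (Rmin_l (coord x k - coord (fst h) k) (coord (snd h) k - coord x k)).
      pose proof (Rmin_r (coord x k - coord (fst h) k) (coord (snd h) k - coord x k)).
      lra.
  - intros [Bx Nx] e He.
    destruct (classic (exists h, In h L /\ box (fst h) (snd h) x)) as [[h [Hh Bh]]|Hn].
    + destruct (box_not_open _ _ _ Bh (Nx h Hh)) as [k [Hk E]].
      destruct (hole_range h k Hh Hk) as [_ [R1 [R2 [R3 R4]]]].
      destruct (holes_near L x) as [e' [He' Near]].
      pose proof (Bx k Hk) as Bxk.
      (* [s] selects the direction leading out of [h]; the first clause measures the room left in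
         the box that way. *)
      assert (exists s : bool, 0 < (if s then coord hi k - coord x k else coord x k - coord lo k)
        /\ forall t, 0 < t -> ~ box (fst h) (snd h) (shift x t (face_normal k s)))
        as [s [Hs Out]].
      { destruct E as [E|E]; [exists false|exists true]; (split; [lra|]);
          intros t Ht B; specialize (B k Hk);
          rewrite coord_shift, coord_face_normal, Nat.eqb_refl in B by assumption; lra. }
      destruct (exists_small_shift x (face_normal k s) (Rmin e e')) as [t0 [P0 S]];
        [now apply Rmin_glb_lt|].
      pose proof (Rmin_l e e'); pose proof (Rmin_r e e').
      pose (g := if s then coord hi k - coord x k else coord x k - coord lo k).
      fold g in Hs.
      pose (t := Rmin (t0 / 2) g).
      assert (Ht : 0 < t) by (apply Rmin_glb_lt; lra).
      assert (t <= t0 / 2) by apply Rmin_l. assert (t <= g) by apply Rmin_r.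
      specialize (S t ltac:(apply Rabs_def1; lra)).
      exists (shift x t (face_normal k s)). split; [split|lra].
      * intros l Hl. rewrite coord_shift, coord_face_normal by assumption.
        specialize (Bx l Hl). destruct (Nat.eqb_spec l k) as [->|_]; [|lra].
        unfold g in *. destruct s; lra.
      * intros h' Hh' B'.
        assert (h = h') as <-; [|now apply (Out t)].
        apply (holes_meet h h' x); auto. apply (Near (shift x t (face_normal k s))); auto; lra.
    + exists x. rewrite dist_refl. split; [split; [exact Bx|]|exact He].
      intros h Hh Bh. eauto.
Qed.

Lemma hb_closed : is_closed P.
Proof.
  intros x Nx. apply NNPP; intros Hn. apply Nx. apply (hb_closure _ _ _ _ _ HB).
  intros e He. apply NNPP; intros Hn'. apply Hn. exists (e / 2). split; [lra|].
  intros y Dy Py. apply (hb_closure _ _ _ _ _ HB) in Py.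
  destruct (Py (e / 2)) as [z [Az Dz]]; [lra|]. apply Hn'. exists z. split; [exact Az|].
  pose proof (dist_tri x y z). lra.
Qed.

(** Near [x] lies a box point [y] off all closed holes. If [y] is in the given plane, a small step
    towards a box point outside the plane stays in the convex box and still misses the holes. *)
Lemma hb_thick : thick P.
Proof.
  intros x n c e Px Hn He. apply (hb_closure _ _ _ _ _ HB) in Px.
  destruct (Px (e / 2)) as [y [[By Ny] Dy]]; [lra|].
  assert (Py : P y).
  { apply (hb_closure _ _ _ _ _ HB), closure_sub. auto. }
  destruct (Req_dec_T (dot n y) c) as [E|E]; [|exists y; repeat split; auto; lra].
  assert (V := hb_valid _ _ _ _ _ HB).
  (* The corner [lo] and its three neighbouring corners in one plane would force [n] to vanish. *)
  assert (exists m, box lo hi m /\ dot n m <> c) as [m [Bm Hm]].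
  { apply NNPP; intros Hall.
    assert (A : forall m, box lo hi m -> dot n m = c)
      by (intros m Bm; apply NNPP; intros Hm; eauto).
    assert (A0 : dot n lo = c).
    { apply A. intros k Hk. specialize (V k Hk). lra. }
    assert (Ak : forall k, (k < 3)%nat ->
      dot n (shift lo (coord hi k - coord lo k) (face_normal k true)) = c).
    { intros k Hk. apply A. intros l Hl.
      rewrite coord_shift, coord_face_normal by assumption.
      specialize (V l Hl) as Vl.
      destruct (Nat.eqb_spec l k) as [->|_]; lra. }
    assert (Z : forall k, (k < 3)%nat -> dot n (face_normal k true) = 0).
    { intros k Hk. specialize (Ak k Hk). rewrite dot_shift in Ak.
      specialize (V k Hk). nra. }
    apply Hn. destruct n as [n0 n1 n2].
    assert (Z0 := Z 0%nat ltac:(lia)). assert (Z1 := Z 1%nat ltac:(lia)).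
    assert (Z2 := Z 2%nat ltac:(lia)). unfold dot in *; simpl in *. f_equal; lra. }
  destruct (holes_near L y) as [e' [He' Near]].
  destruct (exists_small_shift y (vsub m y) (Rmin (e / 2) e')) as [t0 [P0 S]];
    [apply Rmin_glb_lt; lra|].
  pose proof (Rmin_l (e / 2) e'); pose proof (Rmin_r (e / 2) e').
  pose (t := Rmin (t0 / 2) 1).
  assert (Ht : 0 < t) by (apply Rmin_glb_lt; lra).
  assert (t <= t0 / 2) by apply Rmin_l. assert (t <= 1) by apply Rmin_r.
  specialize (S t ltac:(apply Rabs_def1; lra)).
  exists (shift y t (vsub m y)). split; [|split].
  - apply (hb_closure _ _ _ _ _ HB), closure_sub. split.
    + intros k Hk. rewrite coord_shift. specialize (By k Hk). specialize (Bm k Hk).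
      replace (coord (vsub m y) k) with (coord m k - coord y k)
        by (destruct k as [|[|k]]; simpl; ring).
      split; nra.
    + intros h Hh Bh. apply (Ny h Hh). apply (Near (shift y t (vsub m y))); auto; lra.
  - pose proof (dist_tri x y (shift y t (vsub m y))). lra.
  - rewrite dot_shift. replace (dot n (vsub m y)) with (dot n m - dot n y)
      by (unfold dot; simpl; ring). nra.
Qed.

(** A point slightly ahead of [y] in the normal direction is outside [P] but still in the box, hence
    in an open hole. That hole contains [y] in its closure but not in its interior, so [y] lies on
    the side just crossed. *)
Lemma half_space_on_hole (k : nat) (s : bool) (y : pt) :
  (k < 3)%nat -> half_space_at P (face_normal k s) y ->
  coord lo k < coord y k < coord hi k ->
  exists h, In h L /\ box (fst h) (snd h) y /\ coord y k = side h k s.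
Proof.
  intros Hk HS Hy.
  assert (Py : P y).
  { apply NNPP; intros Ny. destruct (hb_closed y Ny) as [d [Hd D]].
    apply (half_space_boundary P _ y (face_normal_neq0 k s)) in HS.
    destruct (HS d Hd) as [[z [Pz Dz]] _]. exact (D z Dz Pz). }
  destruct HS as [e [He H]].
  destruct (holes_near L y) as [e' [He' Near]].
  destruct (exists_small_shift y (face_normal k s) (Rmin e e')) as [t0 [P0 S]];
    [now apply Rmin_glb_lt|].
  pose proof (Rmin_l e e'); pose proof (Rmin_r e e').
  pose (g := Rmin (coord hi k - coord y k) (coord y k - coord lo k)).
  assert (Hg : 0 < g) by (apply Rmin_glb_lt; lra).
  assert (g <= coord hi k - coord y k) by apply Rmin_l.
  assert (g <= coord y k - coord lo k) by apply Rmin_r.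
  pose (t := Rmin (t0 / 2) g).
  assert (Ht : 0 < t) by (apply Rmin_glb_lt; lra).
  assert (t <= t0 / 2) by apply Rmin_l. assert (t <= g) by apply Rmin_r.
  specialize (S t ltac:(apply Rabs_def1; lra)).
  pose (z := shift y t (face_normal k s)). fold z in S.
  assert (Cz : forall l, (l < 3)%nat -> coord z l =
    coord y l + if Nat.eqb l k then (if s then t else - t) else 0).
  { intros l Hl. unfold z. rewrite coord_shift, coord_face_normal by assumption.
    destruct (Nat.eqb l k), s; ring. }
  assert (Nz : ~ P z).
  { apply (H z ltac:(lra)). unfold z. rewrite dot_shift, face_normal_unit. lra. }
  destruct (proj1 (hb_mem y) Py) as [By Oy].
  assert (Bz : box lo hi z).
  { intros l Hl. rewrite (Cz l Hl). specialize (By l Hl).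
    destruct (Nat.eqb_spec l k) as [->|_]; [destruct s; lra|lra]. }
  assert (exists h, In h L /\ open_box (fst h) (snd h) z) as [h [Hh Oz]].
  { apply NNPP; intros Hn. apply Nz, hb_mem. split; [exact Bz|].
    intros h Hh Oz. eauto. }
  assert (Bh : box (fst h) (snd h) y).
  { apply (Near z); [lra|exact Hh|]. intros l Hl. specialize (Oz l Hl). lra. }
  exists h. split; [exact Hh|]. split; [exact Bh|].
  (* [y] and [z] differ along axis [k] only. *)
  assert (Nk : ~ (coord (fst h) k < coord y k < coord (snd h) k)).
  { intros Ok. apply (Oy h Hh). intros l Hl. destruct (Nat.eq_dec l k) as [->|Hlk]; [exact Ok|].
    specialize (Oz l Hl). rewrite (Cz l Hl) in Oz.
    destruct (Nat.eqb_spec l k); [contradiction|lra]. }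
  specialize (Oz k Hk). rewrite (Cz k Hk), Nat.eqb_refl in Oz. specialize (Bh k Hk).
  unfold side. destruct s; lra.
Qed.

(** * What a markup reveals about one polyhedron *)

Section Markup.

Variable M : list marker.
Hypothesis HM : marker_per_face_markup P M.

Lemma marker_in_box (m : marker) : In m M -> box lo hi (fst m).
Proof.
  intros Hm. destruct (proj1 HM m Hm) as [F [[p [_ HF]] [Fm _]]].
  apply HF in Fm. apply (closure_box lo hi) in Fm; [exact Fm|].
  intros y Cy. apply component_sub in Cy. destruct Cy as [By _].
  apply NNPP; intros Ny. destruct (not_box_away lo hi y Ny) as [e [He H]].
  destruct (By e He) as [[z [Pz Dz]] _]. apply (H z Dz). now apply hb_mem.
Qed.

(** The half-space property may fail at the marker itself, so the hole is read off at a nearby point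
    of the component, which has the same [k]-coordinate; by closedness that hole also contains the
    marker. *)
Lemma marker_on_hole (m : marker) (k : nat) (s : bool) :
  In m M -> (k < 3)%nat -> snd m = face_normal k s ->
  coord lo k < coord (fst m) k < coord hi k ->
  exists h, In h L /\ box (fst h) (snd h) (fst m) /\ coord (fst m) k = side h k s.
Proof.
  intros Hm Hk Em Im. destruct (proj1 HM m Hm) as [F [[p [Fp HF]] [Fm ON]]].
  assert (HS := face_half_space P F p (snd m) hb_closed hb_thick HF ON).
  destruct ON as [_ [[c Hc] _]]. rewrite Em in *.
  destruct (holes_near L (fst m)) as [e [He Near]].
  destruct (proj1 (HF (fst m)) Fm e He) as [y [Cy Dy]].
  assert (Ey : coord y k = coord (fst m) k).
  { assert (E1 := Hc (fst m) Fm). assert (E2 := Hc y (proj2 (HF y) (closure_sub _ _ Cy))).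
    rewrite face_normal_dot in E1, E2 by assumption. destruct s; lra. }
  destruct (half_space_on_hole k s y Hk (HS y Cy) ltac:(lra)) as [h [Hh [Bh Eh]]].
  exists h. split; [exact Hh|]. split; [now apply (Near y)|lra].
Qed.

Lemma exists_face_marker (k : nat) (s : bool) (p : pt) :
  (k < 3)%nat -> half_space_at P (face_normal k s) p ->
  exists m, In m M /\ snd m = face_normal k s /\ coord (fst m) k = coord p k /\
    closure (component (flat_points P) p) (fst m) /\
    forall y, component (flat_points P) p y ->
      half_space_at P (face_normal k s) y /\ coord y k = coord p k.
Proof.
  intros Hk HS.
  assert (Fp : flat_points P p) by (apply half_space_flat with (face_normal k s);
    [apply face_normal_neq0|exact HS]).
  pose (F := closure (component (flat_points P) p)).
  assert (Cp : component (flat_points P) p p).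
  (* A degenerate segment serves as the connected singleton. *)
  { exists (segment p p). assert (Ip : segment p p p)
      by (exists 0; split; [lra|]; now rewrite shift0).
    split; [|split; [apply segment_connected|split; exact Ip]].
    intros z [t [_ ->]]. replace (shift p t (vsub p p)) with p; [apply Fp|].
    destruct p; unfold shift, vsub, vadd, vscale; simpl; f_equal; ring. }
  destruct (proj2 HM F) as [m [Hm [Fm ON]]].
  { exists p. split; [exact Fp|]. intros y. reflexivity. }
  assert (HSy := face_half_space P F p (snd m) hb_closed hb_thick (fun y => iff_refl _) ON).
  assert (En : snd m = face_normal k s).
  { apply (half_space_unit_normal_unique P _ _ p); auto.
    - apply ON.
    - apply face_normal_unit. }
  destruct ON as [_ [[c Hc] _]]. rewrite En in *.
  assert (Ck : forall y, F y -> coord y k = coord p k).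
  { intros y Fy. assert (E1 := Hc y Fy). assert (E2 := Hc p (closure_sub _ _ Cp)).
    rewrite face_normal_dot in E1, E2 by assumption. destruct s; lra. }
  exists m. split; [exact Hm|]. split; [exact En|]. split; [now apply Ck|].
  split; [exact Fm|]. intros y Cy. split; [now apply HSy|]. now apply Ck, closure_sub.
Qed.

(** Several holes may have coplanar sides with the same normal, so level and direction do not
    identify [h]. The marker is tied to [h] because the component through the middle of the side
    cannot pass to another hole. *)
Lemma hole_side_marker (h : hole) (k : nat) (s : bool) :
  In h L -> (k < 3)%nat -> coord lo k < side h k s < coord hi k ->
  exists m, In m M /\ snd m = face_normal k s /\ coord (fst m) k = side h k s /\
    box (fst h) (snd h) (fst m).
Proof.
  intros Hh Hk Hs.
  assert (V := hb_valid _ _ _ _ _ HB).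
  (* [u] and [v] trim the hole to the box, since its overshoot carries no boundary of [P]. *)
  pose (u := fun l => Rmax (coord (fst h) l) (coord lo l)).
  pose (v := fun l => Rmin (coord (snd h) l) (coord hi l)).
  assert (Huv : forall l, (l < 3)%nat -> u l < v l /\ coord (fst h) l <= u l /\
    coord lo l <= u l /\ v l <= coord (snd h) l /\ v l <= coord hi l).
  { intros l Hl. destruct (hole_range h l Hh Hl) as [R1 [R2 [R3 _]]].
    specialize (V l Hl). split; [|split; [|split; [|split]]];
      [apply Rmax_lub_lt; apply Rmin_glb_lt; assumption
      |apply Rmax_l|apply Rmax_r|apply Rmin_l|apply Rmin_r]. }
  pose (p := mk (fun l => if Nat.eqb l k then side h k s else (u l + v l) / 2)).
  assert (Pk : coord p k = side h k s)
    by (unfold p; rewrite coord_mk, Nat.eqb_refl; auto).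
  assert (Pl : forall l, (l < 3)%nat -> l <> k -> coord p l = (u l + v l) / 2).
  { intros l Hl Hlk. unfold p. rewrite coord_mk by assumption.
    destruct (Nat.eqb_spec l k); [contradiction|reflexivity]. }
  assert (Hw : forall l, (l < 3)%nat -> l <> k -> u l < coord p l < v l).
  { intros l Hl Hlk. rewrite (Pl l Hl Hlk). destruct (Huv l Hl). lra. }
  assert (Bp : box (fst h) (snd h) p).
  { intros l Hl. destruct (hole_range h l Hh Hl) as [R1 _].
    destruct (Nat.eq_dec l k) as [->|Hlk].
    - rewrite Pk. unfold side. destruct s; lra.
    - specialize (Hw l Hl Hlk). specialize (Huv l Hl). lra. }
  assert (HS : half_space_at P (face_normal k s) p).
  { destruct (holes_near L p) as [e' [He' Near]].
    (* The radius stays within the trimmed hole sideways, away from the box faces along axis [k],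
       and below the thickness of the hole, so that its far side is not reached. *)
    pose (g := fun l => Rmin
      (if Nat.eqb l k then Rmin (coord p k - coord lo k) (coord hi k - coord p k)
       else Rmin (coord p l - u l) (v l - coord p l))
      (coord (snd h) k - coord (fst h) k)).
    assert (Hg : forall l, (l < 3)%nat -> 0 < g l).
    { intros l Hl. destruct (hole_range h k Hh Hk) as [R1 _].
      apply Rmin_glb_lt; [|lra]. destruct (Nat.eqb_spec l k) as [->|Hlk].
      - rewrite Pk. apply Rmin_glb_lt; lra.
      - specialize (Hw l Hl Hlk). apply Rmin_glb_lt; lra. }
    destruct (min_coord g Hg) as [e [He Heg]].
    exists (Rmin e' e). split; [now apply Rmin_glb_lt|]. intros z Dz0.
    assert (Dz' : dist p z < e') by (eapply Rlt_le_trans; [exact Dz0|apply Rmin_l]).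
    assert (Dz : dist p z < e) by (eapply Rlt_le_trans; [exact Dz0|apply Rmin_r]).
    assert (Zk : coord lo k < coord z k < coord hi k /\
      coord p k - (coord (snd h) k - coord (fst h) k) < coord z k <
      coord p k + (coord (snd h) k - coord (fst h) k)).
    { assert (E := Heg k Hk). unfold g in E. rewrite Nat.eqb_refl in E.
      apply coord_close with (k := k) in Dz.
      pose proof (Rmin_l (Rmin (coord p k - coord lo k) (coord hi k - coord p k))
                    (coord (snd h) k - coord (fst h) k)).
      pose proof (Rmin_r (Rmin (coord p k - coord lo k) (coord hi k - coord p k))
                    (coord (snd h) k - coord (fst h) k)).
      pose proof (Rmin_l (coord p k - coord lo k) (coord hi k - coord p k)).
      pose proof (Rmin_r (coord p k - coord lo k) (coord hi k - coord p k)). lra. }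
    assert (Zl : forall l, (l < 3)%nat -> l <> k -> u l < coord z l < v l).
    { intros l Hl Hlk. assert (E := Heg l Hl). unfold g in E.
      destruct (Nat.eqb_spec l k); [contradiction|].
      apply coord_close with (k := l) in Dz.
      pose proof (Rmin_l (Rmin (coord p l - u l) (v l - coord p l))
                    (coord (snd h) k - coord (fst h) k)).
      pose proof (Rmin_l (coord p l - u l) (v l - coord p l)).
      pose proof (Rmin_r (coord p l - u l) (v l - coord p l)). lra. }
    rewrite !face_normal_dot, Pk by assumption. rewrite Pk in Zk. split; intros Lt.
    - apply hb_mem. split.
      + intros l Hl. destruct (Nat.eq_dec l k) as [->|Hlk]; [lra|].
        specialize (Zl l Hl Hlk). specialize (Huv l Hl). lra.
      + intros h' Hh' Oz.
        assert (h = h') as <-.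
        { apply (holes_meet h h' p); auto. apply (Near z); auto.
          intros l Hl. specialize (Oz l Hl). lra. }
        specialize (Oz k Hk). unfold side in *. destruct s; lra.
    - intros Pz. apply hb_mem in Pz as [_ Pz]. apply (Pz h Hh). intros l Hl.
      destruct (Nat.eq_dec l k) as [->|Hlk].
      + unfold side in *. destruct s; lra.
      + specialize (Zl l Hl Hlk). specialize (Huv l Hl). lra. }
  destruct (exists_face_marker k s p Hk HS) as [m [Hm [En [Ek [Cm HC]]]]].
  exists m. split; [exact Hm|]. split; [exact En|]. split; [congruence|].
  apply (closure_box (fst h) (snd h)) in Cm; [exact Cm|]. clear m Hm En Ek Cm.
  intros y [C [CF [CC [Cp Cy]]]]. apply NNPP; intros Ny.
  assert (HC' : forall z, C z -> exists h', In h' L /\ box (fst h') (snd h') z).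
  { intros z Cz. destruct (HC z) as [HSz Ez]; [now exists C|].
    destruct (half_space_on_hole k s z Hk HSz) as [h' [Hh' [Bh' _]]]; [rewrite Ez; lra|].
    now exists h'. }
  (* The closed holes are pairwise disjoint, so membership in [h] is locally constant on [C]. *)
  pose (N := fun (Q : Prop -> Prop) (x : pt) => exists z e, 0 < e /\ dist z x < e /\
    Q (box (fst h) (snd h) z) /\ forall w h', dist z w < e -> In h' L ->
      box (fst h') (snd h') w -> box (fst h') (snd h') z).
  assert (ON : forall Q, is_open (N Q)).
  { intros Q x [z [e [He [Dx [Qz H]]]]]. exists (e - dist z x). split; [lra|].
    intros w Dw. exists z, e. split; [exact He|]. split; [|split; [exact Qz|exact H]].
    pose proof (dist_tri z x w). lra. }
  assert (IN : forall (Q : Prop -> Prop) z, Q (box (fst h) (snd h) z) -> N Q z).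
  { intros Q z Qz. destruct (holes_near L z) as [e [He H]].
    exists z, e. rewrite dist_refl. auto. }
  apply CC. exists (N (fun A => A)), (N not).
  split; [apply ON|]. split; [apply ON|]. split; [|split; [|split]].
  - intros z Cz. destruct (classic (box (fst h) (snd h) z)); [left|right]; now apply IN.
  - intros z Cz [z1 [e1 [_ [D1 [B1 H1]]]]] [z2 [e2 [_ [D2 [B2 H2]]]]].
    destruct (HC' z Cz) as [h' [Hh' Bh']].
    assert (h = h') as <- by (apply (holes_meet h h' z1); eauto).
    apply B2. eauto.
  - exists p. split; [exact Cp|]. now apply IN.
  - exists y. split; [exact Cy|]. now apply IN.
Qed.

(** The test point has its other coordinates in the margin above [lo]. On the faces across axis [i]
    a lateral coordinate keeps it clear of the holes; on the remaining faces the holes end strictly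
    before the face. *)
Lemma box_side_marker (k : nat) (s : bool) : (k < 3)%nat ->
  exists m, In m M /\ coord (fst m) k = face_level lo hi k s.
Proof.
  intros Hk. destruct (lateral_margin lo hi i L) as [d [P0 [D1 D2]]];
    [apply (hb_valid _ _ _ _ _ HB)|apply (hb_lateral _ _ _ _ _ HB)|].
  pose (p := mk (fun l => if Nat.eqb l k then face_level lo hi k s else coord lo l + d)).
  assert (Pk : coord p k = face_level lo hi k s)
    by (unfold p; rewrite coord_mk, Nat.eqb_refl; auto).
  assert (Pl : forall l, (l < 3)%nat -> l <> k -> coord p l = coord lo l + d).
  { intros l Hl Hlk. unfold p. rewrite coord_mk by assumption.
    destruct (Nat.eqb_spec l k); [contradiction|reflexivity]. }
  assert (V := hb_valid _ _ _ _ _ HB).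
  assert (Np : forall h, In h L -> ~ box (fst h) (snd h) p).
  { intros h Hh B. destruct (Nat.eq_dec k i) as [->|Hki].
    - assert (exists l, (l < 3)%nat /\ l <> i) as [l [Hl Hli]].
      { destruct (Nat.eq_dec i 0); [exists 1%nat|exists 0%nat]; lia. }
      specialize (B l Hl). rewrite (Pl l Hl Hli) in B. specialize (D2 h l Hh Hl Hli). lra.
    - specialize (B k Hk). rewrite Pk in B.
      pose proof (hb_lateral _ _ _ _ _ HB h k Hh Hk Hki).
      unfold face_level in B. destruct s; lra. }
  assert (HS : half_space_at P (face_normal k s) p).
  { destruct (holes_near L p) as [e' [He' Near]].
    pose (g := fun l => Rmin d (coord hi l - coord lo l - d)).
    assert (Hg : forall l, (l < 3)%nat -> 0 < g l)
      by (intros l Hl; specialize (D1 l Hl); apply Rmin_glb_lt; lra).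
    destruct (min_coord g Hg) as [e [He Heg]].
    exists (Rmin e' e). split; [now apply Rmin_glb_lt|]. intros z Dz0.
    assert (Dz' : dist p z < e') by (eapply Rlt_le_trans; [exact Dz0|apply Rmin_l]).
    assert (Dz : dist p z < e) by (eapply Rlt_le_trans; [exact Dz0|apply Rmin_r]).
    assert (Zl : forall l, (l < 3)%nat -> coord p l - d < coord z l < coord p l + d /\
      coord p l - (coord hi l - coord lo l - d) < coord z l <
      coord p l + (coord hi l - coord lo l - d)).
    { intros l Hl. assert (E := Heg l Hl). unfold g in E.
      pose proof (coord_close p z l _ Dz).
      pose proof (Rmin_l d (coord hi l - coord lo l - d)).
      pose proof (Rmin_r d (coord hi l - coord lo l - d)). lra. }
    rewrite !face_normal_dot, Pk by assumption. split; intros Lt.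
    - apply hb_mem. split.
      + intros l Hl. specialize (Zl l Hl). destruct (Nat.eq_dec l k) as [->|Hlk].
        * rewrite Pk in Zl. specialize (D1 k Hk). unfold face_level in *. destruct s; lra.
        * rewrite (Pl l Hl Hlk) in Zl. lra.
      + intros h Hh Oz. apply (Np h Hh), (Near z); auto.
        intros l Hl. specialize (Oz l Hl). lra.
    - intros Pz. apply hb_mem in Pz as [Bz _]. specialize (Bz k Hk).
      unfold face_level in *. destruct s; lra. }
  destruct (exists_face_marker k s p Hk HS) as [m [Hm [_ [Ek _]]]].
  exists m. split; [exact Hm|]. congruence.
Qed.

End Markup.
End HoledBox.

(** * From intrusion data to boxes with holes *)

(** [deep] tests whether the intrusion stops short of the opposite face and so has a floor; at full
    depth that end overshoots by 1 as well. *)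
Definition hole_of (lo hi : pt) (i : nat) (s : bool) (D : intr_datum) : hole :=
  let '(c, e, d) := D in
  let deep := Rlt_dec d (coord hi i - coord lo i) in
  (mk (fun k => if Nat.eqb k i
                then (if s then (if deep then coord hi i - d else coord lo i - 1)
                      else coord lo i - 1)
                else coord c k),
   mk (fun k => if Nat.eqb k i
                then (if s then coord hi i + 1
                      else (if deep then coord lo i + d else coord hi i + 1))
                else coord e k)).

Lemma intrusion_iff_hole (lo hi : pt) (i : nat) (s : bool) (c e : pt) (d : R) (y : pt) :
  (i < 3)%nat -> 0 < d <= coord hi i - coord lo i -> box lo hi y ->
  intrusion (rect i (face_level lo hi i s) c e) (face_normal i s) d y <->
  box (fst (hole_of lo hi i s (c, e, d))) (snd (hole_of lo hi i s (c, e, d))) y.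
Proof.
  intros Hi Hd By. unfold hole_of; simpl fst; simpl snd.
  assert (Sub : forall x t k, (k < 3)%nat -> coord (vsub x (vscale t (face_normal i s))) k =
    coord x k - if Nat.eqb k i then (if s then t else - t) else 0).
  { intros x t k Hk.
    replace (coord (vsub x (vscale t (face_normal i s))) k)
      with (coord x k - t * coord (face_normal i s) k)
      by (destruct k as [|[|k]]; simpl; ring).
    rewrite coord_face_normal by assumption. destruct (Nat.eqb k i), s; ring. }
  split.
  - intros [x [t [[Ex Rx] [Ht ->]]]] k Hk. rewrite !coord_mk by assumption.
    pose proof (By k Hk) as Byk. rewrite Sub in Byk |- * by assumption.
    destruct (Nat.eqb_spec k i) as [->|Hki].
    + rewrite Ex in *. unfold face_level in *.
      destruct s; destruct (Rlt_dec d (coord hi i - coord lo i)); lra.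
    + specialize (Rx k Hk Hki). lra.
  - intros Bh.
    (* [t] is the depth of [y] below the intruded face, and the rectangle point is its perpendicular
       projection there. *)
    pose (t := if s then coord hi i - coord y i else coord y i - coord lo i).
    exists (shift y t (face_normal i s)), t.
    assert (Cx : forall k, (k < 3)%nat -> coord (shift y t (face_normal i s)) k =
      coord y k + if Nat.eqb k i then (if s then t else - t) else 0).
    { intros k Hk. rewrite coord_shift, coord_face_normal by assumption.
      destruct (Nat.eqb k i), s; ring. }
    pose proof (By i Hi) as Byi. specialize (Bh i Hi) as Bhi.
    rewrite !coord_mk, Nat.eqb_refl in Bhi by assumption.
    split; [split|split].
    + rewrite Cx, Nat.eqb_refl by assumption. unfold t, face_level. destruct s; ring.
    + intros k Hk Hki. rewrite Cx by assumption. specialize (Bh k Hk).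
      rewrite !coord_mk in Bh by assumption.
      destruct (Nat.eqb_spec k i); [contradiction|lra].
    + unfold t. destruct s; destruct (Rlt_dec d (coord hi i - coord lo i)); lra.
    + apply pt_ext. intros k Hk. rewrite Sub, Cx by assumption.
      destruct (Nat.eqb k i), s; ring.
Qed.

Lemma closure_ext (A B : pset) (x : pt) :
  (forall y, A y <-> B y) -> (closure A x <-> closure B x).
Proof.
  intros E. split; intros C e He; destruct (C e He) as [y [Hy Dy]];
    exists y; split; auto; now apply E.
Qed.

Lemma intruded_box_holed (P : pset) : intruded_box P ->
  exists lo hi i L, holed_box P lo hi i L.
Proof.
  intros [lo [hi [i [s [L [V [Hi [HL [HD HP]]]]]]]]].
  exists lo, hi, i, (map (hole_of lo hi i s) L).
  assert (HL' : forall h, In h (map (hole_of lo hi i s) L) -> exists c e d,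
    h = hole_of lo hi i s (c, e, d) /\ rect_in_relint lo hi i c e /\
    0 < d <= coord hi i - coord lo i).
  { intros h Hh. apply in_map_iff in Hh as [[[c e] d] [<- HI]].
    apply (@In_nth intr_datum _ _ (lo, hi, 0)) in HI as [j [Hj Ej]].
    specialize (HL j Hj). rewrite Ej in HL. now exists c, e, d. }
  assert (Vi := V i Hi).
  constructor; auto.
  - intros h k Hh Hk Hki. destruct (HL' h Hh) as [c [e [d [-> [HR _]]]]].
    unfold hole_of; simpl fst; simpl snd. rewrite !coord_mk by assumption.
    destruct (Nat.eqb_spec k i); [contradiction|]. exact (HR k Hk Hki).
  - intros h Hh. destruct (HL' h Hh) as [c [e [d [-> [_ Hd]]]]].
    unfold hole_of; simpl fst. rewrite !coord_mk, Nat.eqb_refl by assumption.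
    destruct s; [destruct (Rlt_dec d (coord hi i - coord lo i))|]; [right|left|left]; lra.
  - intros h Hh. destruct (HL' h Hh) as [c [e [d [-> [_ Hd]]]]].
    unfold hole_of; simpl snd. rewrite !coord_mk, Nat.eqb_refl by assumption.
    destruct s; [|destruct (Rlt_dec d (coord hi i - coord lo i))]; [left|right|left]; lra.
  - destruct s; [right|left]; intros h Hh; destruct (HL' h Hh) as [c [e [d [-> _]]]];
      unfold hole_of; simpl fst; simpl snd; rewrite !coord_mk, Nat.eqb_refl by assumption;
      reflexivity.
  - intros h h' Hh Hh'. apply in_map_iff in Hh as [D [<- HI]], Hh' as [D' [<- HI']].
    apply (@In_nth intr_datum _ _ (lo, hi, 0)) in HI as [j [Hj Ej]], HI' as [j' [Hj' Ej']].
    destruct (Nat.eq_dec j j') as [<-|Hne]; [left; congruence|right].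
    specialize (HD j j' Hj Hj' Hne). pose proof (HL j Hj) as R1. pose proof (HL j' Hj') as R2.
    rewrite Ej, Ej' in *. destruct D as [[c e] d], D' as [[c' e'] d'].
    destruct R1 as [R1 _], R2 as [R2 _]. apply NNPP; intros Hn.
    unfold hole_of in Hn; simpl fst in Hn; simpl snd in Hn.
    (* If no lateral axis separates two rectangles, the coordinatewise maximum of their lower
       corners lies in both. *)
    apply (HD (mk (fun k => if Nat.eqb k i then face_level lo hi i s
                            else Rmax (coord c k) (coord c' k)))).
    assert (Mx : forall k, (k < 3)%nat -> k <> i ->
      Rmax (coord c k) (coord c' k) <= coord e k /\
      Rmax (coord c k) (coord c' k) <= coord e' k).
    { intros k Hk Hki.
      assert (~ (coord e k < coord c' k \/ coord e' k < coord c k)) as Hs.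
      { intros Hs. apply Hn. exists k. rewrite !coord_mk by assumption.
        destruct (Nat.eqb_spec k i); [contradiction|auto]. }
      specialize (R1 k Hk Hki). specialize (R2 k Hk Hki).
      split; apply Rmax_lub; lra. }
    split; (split; [rewrite coord_mk, Nat.eqb_refl by assumption; reflexivity|]);
      intros k Hk Hki; rewrite coord_mk by assumption;
      (destruct (Nat.eqb_spec k i); [contradiction|]);
      pose proof (Rmax_l (coord c k) (coord c' k));
      pose proof (Rmax_r (coord c k) (coord c' k));
      specialize (Mx k Hk Hki); lra.
  - intros x. rewrite HP. apply closure_ext. intros y. split; intros [By Ny]; split; auto.
    + intros h Hh Bh. apply in_map_iff in Hh as [[[c e] d] [<- HI]].
      apply (@In_nth intr_datum _ _ (lo, hi, 0)) in HI as [j [Hj Ej]].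
      apply Ny. exists j. split; [exact Hj|]. specialize (HL j Hj). rewrite Ej in *.
      apply intrusion_iff_hole; auto. apply HL.
    + intros [j [Hj Ij]]. specialize (HL j Hj).
      assert (HI : In (nth j L (lo, hi, 0)) L) by now apply nth_In.
      destruct (nth j L (lo, hi, 0)) as [[c e] d].
      apply (Ny (hole_of lo hi i s (c, e, d))); [now apply in_map|].
      apply intrusion_iff_hole; auto. apply HL.
Qed.

(** * Comparing two markups *)

(** Each outer face of the first box carries a marker, and every marker lies in the second box. *)
Lemma holed_box_le (P P' : pset) (lo hi lo' hi' : pt) (i i' : nat) (L L' : list hole)
    (M : list marker) :
  holed_box P lo hi i L -> holed_box P' lo' hi' i' L' ->
  marker_per_face_markup P M -> marker_per_face_markup P' M ->
  forall k, (k < 3)%nat -> coord lo' k <= coord lo k /\ coord hi k <= coord hi' k.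
Proof.
  intros HB HB' HM HM' k Hk.
  destruct (box_side_marker P lo hi i L HB M HM k true Hk) as [m [Im Em]].
  destruct (box_side_marker P lo hi i L HB M HM k false Hk) as [n [In En]].
  pose proof (marker_in_box P' lo' hi' i' L' HB' M HM' m Im k Hk).
  pose proof (marker_in_box P' lo' hi' i' L' HB' M HM' n In k Hk).
  simpl in Em, En. lra.
Qed.

(** All that is retained of the common markup once the boxes agree: [p] is the position of a marker
    on a wall or floor strictly inside the box range, as read in both polyhedra. *)
Definition sides_shared (lo hi : pt) (L L' : list hole) : Prop :=
  forall h k s, In h L -> (k < 3)%nat -> coord lo k < side h k s < coord hi k ->
    exists h' p, In h' L' /\ box (fst h) (snd h) p /\ box (fst h') (snd h') p /\
      coord p k = side h k s /\ side h' k s = side h k s.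

Lemma markup_sides_shared (P P' : pset) (lo hi : pt) (i i' : nat) (L L' : list hole)
    (M : list marker) :
  holed_box P lo hi i L -> holed_box P' lo hi i' L' ->
  marker_per_face_markup P M -> marker_per_face_markup P' M ->
  sides_shared lo hi L L'.
Proof.
  intros HB HB' HM HM' h k s Hh Hk Hs.
  destruct (hole_side_marker P lo hi i L HB M HM h k s Hh Hk Hs) as [m [Im [En [Ek Bm]]]].
  destruct (marker_on_hole P' lo hi i' L' HB' M HM' m k s Im Hk En ltac:(rewrite Ek; exact Hs))
    as [h' [Hh' [Bm' Ek']]].
  exists h', (fst m). repeat split; try congruence; first [apply Bm|apply Bm']; assumption.
Qed.

Lemma lateral_side (P : pset) (lo hi : pt) (i : nat) (L : list hole) (h : hole) (k : nat)
    (s : bool) :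
  holed_box P lo hi i L -> In h L -> (k < 3)%nat -> k <> i ->
  coord lo k < side h k s < coord hi k.
Proof.
  intros HB Hh Hk Hki. pose proof (hb_lateral _ _ _ _ _ HB h k Hh Hk Hki).
  unfold side. destruct s; lra.
Qed.

(** A shared wall of [h] supplies a hole [h'] of the other family. Were the axes different, axis [i]
    would be lateral for [h'], so both its ends on it would be inner and shared back with [L], where
    one and the same end always overshoots. Without holes the axis would be undetermined. *)
Lemma same_axis (P P' : pset) (lo hi : pt) (i i' : nat) (L L' : list hole) (h : hole) :
  holed_box P lo hi i L -> holed_box P' lo hi i' L' ->
  sides_shared lo hi L L' -> sides_shared lo hi L' L -> In h L -> i = i'.
Proof.
  intros HB HB' S S' Hh. apply NNPP; intros Hne.
  assert (Hi := hb_axis _ _ _ _ _ HB). assert (Hi' := hb_axis _ _ _ _ _ HB').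
  destruct (S h i' true Hh Hi' (lateral_side P lo hi i L h i' true HB Hh Hi' ltac:(auto)))
    as [h' [_ [Hh' _]]].
  destruct (hb_one_sided _ _ _ _ _ HB) as [O|O].
  - pose proof (lateral_side P' lo hi i' L' h' i true HB' Hh' Hi Hne) as R.
    destruct (S' h' i true Hh' Hi R) as [h1 [_ [Hh1 [_ [_ [_ E]]]]]].
    specialize (O h1 Hh1). unfold side in *. lra.
  - pose proof (lateral_side P' lo hi i' L' h' i false HB' Hh' Hi Hne) as R.
    destruct (S' h' i false Hh' Hi R) as [h1 [_ [Hh1 [_ [_ [_ E]]]]]].
    specialize (O h1 Hh1). unfold side in *. lra.
Qed.

(** [lat1] and [lat2] list the two axes other than [i] in increasing order. *)
Definition lat1 (i : nat) : nat := match i with 0%nat => 1%nat | _ => 0%nat end.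
Definition lat2 (i : nat) : nat := match i with 2%nat => 1%nat | _ => 2%nat end.

Lemma lateral_axes (i : nat) : (i < 3)%nat ->
  (lat1 i < 3)%nat /\ (lat2 i < 3)%nat /\ lat1 i <> i /\ lat2 i <> i /\
  forall k, (k < 3)%nat -> k <> i -> k = lat1 i \/ k = lat2 i.
Proof.
  intros Hi. destruct i as [|[|[|i]]]; simpl; repeat split; try intros k Hk Hki; lia.
Qed.

Definition cross_section (i : nat) (h : hole) : rectangle :=
  mkrect (coord (fst h) (lat1 i)) (coord (snd h) (lat1 i))
         (coord (fst h) (lat2 i)) (coord (snd h) (lat2 i)).

Lemma cross_section_in (i : nat) (h : hole) (p : pt) : (i < 3)%nat ->
  box (fst h) (snd h) p -> in_rect (cross_section i h) (coord p (lat1 i)) (coord p (lat2 i)).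
Proof.
  intros Hi B. destruct (lateral_axes i Hi) as [H1 [H2 _]]. split; apply B; assumption.
Qed.

(** Distinct holes are separated along a lateral axis, hence already in projection, whatever their
    depths. *)
Lemma cross_sections_meet (P : pset) (lo hi : pt) (i : nat) (L : list hole) (h h' : hole)
    (x y : R) :
  holed_box P lo hi i L -> In h L -> In h' L ->
  in_rect (cross_section i h) x y -> in_rect (cross_section i h') x y -> h = h'.
Proof.
  intros HB Hh Hh' [X1 Y1] [X2 Y2].
  destruct (lateral_axes i (hb_axis _ _ _ _ _ HB)) as [_ [_ [_ [_ Lat]]]].
  destruct (hb_disjoint _ _ _ _ _ HB h h' Hh Hh') as [E|[k [Hk [Hki D]]]]; [exact E|].
  simpl in *. destruct (Lat k Hk Hki) as [->| ->]; lra.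
Qed.

Lemma cross_sections_disjoint (P : pset) (lo hi : pt) (i : nat) (L : list hole) :
  holed_box P lo hi i L -> disjoint_family (map (cross_section i) L).
Proof.
  intros HB X Y x y HX HY IX IY.
  apply in_map_iff in HX as [h [<- Hh]], HY as [h' [<- Hh']].
  f_equal. now apply (cross_sections_meet P lo hi i L h h' x y).
Qed.

Lemma cross_sections_touch (P : pset) (lo hi : pt) (i : nat) (L L' : list hole) :
  holed_box P lo hi i L -> sides_shared lo hi L L' ->
  sides_touch (map (cross_section i) L) (map (cross_section i) L').
Proof.
  intros HB S X HX. apply in_map_iff in HX as [h [<- Hh]].
  assert (Hi := hb_axis _ _ _ _ _ HB).
  destruct (lateral_axes i Hi) as [H1 [H2 [N1 [N2 _]]]].
  assert (T : forall k s, (k < 3)%nat -> k <> i -> exists h' p, In h' L' /\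
    in_rect (cross_section i h) (coord p (lat1 i)) (coord p (lat2 i)) /\
    in_rect (cross_section i h') (coord p (lat1 i)) (coord p (lat2 i)) /\
    coord p k = side h k s /\ side h' k s = side h k s).
  { intros k s Hk Hki.
    destruct (S h k s Hh Hk (lateral_side P lo hi i L h k s HB Hh Hk Hki))
      as [h' [p [Hh' [B [B' E]]]]].
    exists h', p. split; [exact Hh'|]. split; [|split; [|exact E]];
      now apply cross_section_in. }
  split; [|split; [|split]].
  - destruct (T (lat1 i) true H1 N1) as [h' [p [Hh' [B [B' [E E']]]]]]. simpl in E, E'.
    exists (cross_section i h'), (coord p (lat2 i)). rewrite E in *.
    split; [now apply in_map|auto].
  - destruct (T (lat1 i) false H1 N1) as [h' [p [Hh' [B [B' [E E']]]]]]. simpl in E, E'.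
    exists (cross_section i h'), (coord p (lat2 i)). rewrite E in *.
    split; [now apply in_map|auto].
  - destruct (T (lat2 i) true H2 N2) as [h' [p [Hh' [B [B' [E E']]]]]]. simpl in E, E'.
    exists (cross_section i h'), (coord p (lat1 i)). rewrite E in *.
    split; [now apply in_map|auto].
  - destruct (T (lat2 i) false H2 N2) as [h' [p [Hh' [B [B' [E E']]]]]]. simpl in E, E'.
    exists (cross_section i h'), (coord p (lat1 i)). rewrite E in *.
    split; [now apply in_map|auto].
Qed.

(** The marker on the floor of [h] lies in some hole [h1] of [L']. It projects into the cross
    section common to [h] and [h'], which forces [h1] to be [h']. *)
Lemma floor_shared (P P' : pset) (lo hi : pt) (i : nat) (L L' : list hole) (h h' : hole)
    (s : bool) :
  holed_box P lo hi i L -> holed_box P' lo hi i L' -> sides_shared lo hi L L' ->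
  In h L -> In h' L' -> cross_section i h = cross_section i h' ->
  coord lo i < side h i s < coord hi i -> side h' i s = side h i s.
Proof.
  intros HB HB' S Hh Hh' EX Hs. assert (Hi := hb_axis _ _ _ _ _ HB).
  destruct (S h i s Hh Hi Hs) as [h1 [p [Hh1 [B [B1 [_ E]]]]]].
  assert (h' = h1) as ->; [|exact E].
  apply (cross_sections_meet P' lo hi i L' h' h1 (coord p (lat1 i)) (coord p (lat2 i))); auto.
  - rewrite <- EX. now apply cross_section_in.
  - now apply cross_section_in.
Qed.

Lemma shared_holes_incl (P P' : pset) (lo hi : pt) (i i' : nat) (L L' : list hole) :
  holed_box P lo hi i L -> holed_box P' lo hi i' L' ->
  sides_shared lo hi L L' -> sides_shared lo hi L' L -> incl L L'.
Proof.
  intros HB HB' S S' h Hh.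
  assert (i = i') as <- by now apply (same_axis P P' lo hi i i' L L' h).
  assert (Hi := hb_axis _ _ _ _ _ HB).
  destruct (lateral_axes i Hi) as [_ [_ [_ [_ Lat]]]].
  assert (IX : In (cross_section i h) (map (cross_section i) L')).
  { apply (touching_families_incl (map (cross_section i) L)); [| | | |now apply in_map].
    - now apply (cross_sections_disjoint P lo hi).
    - now apply (cross_sections_disjoint P' lo hi).
    - now apply (cross_sections_touch P lo hi).
    - now apply (cross_sections_touch P' lo hi). }
  apply in_map_iff in IX as [h' [EX Hh']].
  assert (Flo : forall s, coord lo i < side h i s < coord hi i -> side h' i s = side h i s)
    by (intros s; now apply (floor_shared P P' lo hi i L L')).
  assert (Flo' : forall s, coord lo i < side h' i s < coord hi i -> side h i s = side h' i s)
    by (intros s; now apply (floor_shared P' P lo hi i L' L)).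
  assert (E : forall s k, (k < 3)%nat -> side h' k s = side h k s).
  { intros s k Hk. destruct (Nat.eq_dec k i) as [->|Hki].
    (* An end strictly inside the box in either hole is transferred to the other; if both ends
       overshoot, the fixed amount 1 makes them equal. *)
    - pose proof (hb_lower _ _ _ _ _ HB h Hh). pose proof (hb_upper _ _ _ _ _ HB h Hh).
      pose proof (hb_lower _ _ _ _ _ HB' h' Hh'). pose proof (hb_upper _ _ _ _ _ HB' h' Hh').
      specialize (Flo s). specialize (Flo' s). unfold side in *. destruct s; lra.
    - injection EX as E1 E2 E3 E4. unfold side.
      destruct (Lat k Hk Hki) as [->| ->], s; assumption. }
  assert (h' = h) as <-; [|exact Hh'].
  destruct h as [a b], h' as [a' b']. f_equal; apply pt_ext; intros k Hk.
  - exact (E true k Hk).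
  - exact (E false k Hk).
Qed.

Theorem mainTheorem6 (P P' : pset) (M : list marker) :
  intruded_box P -> intruded_box P' ->
  marker_per_face_markup P M -> marker_per_face_markup P' M ->
  forall x, P x <-> P' x.
Proof.
  intros IP IP' HM HM' x.
  destruct (intruded_box_holed P IP) as [lo [hi [i [L HB]]]].
  destruct (intruded_box_holed P' IP') as [lo' [hi' [i' [L' HB']]]].
  assert (Le := holed_box_le P P' lo hi lo' hi' i i' L L' M HB HB' HM HM').
  assert (Ge := holed_box_le P' P lo' hi' lo hi i' i L' L M HB' HB HM' HM).
  assert (lo = lo') as <-.
  { apply pt_ext. intros k Hk. specialize (Le k Hk). specialize (Ge k Hk). lra. }
  assert (hi = hi') as <-.
  { apply pt_ext. intros k Hk. specialize (Le k Hk). specialize (Ge k Hk). lra. }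
  assert (S := markup_sides_shared P P' lo hi i i' L L' M HB HB' HM HM').
  assert (S' := markup_sides_shared P' P lo hi i' i L' L M HB' HB HM' HM).
  assert (I1 := shared_holes_incl P P' lo hi i i' L L' HB HB' S S').
  assert (I2 := shared_holes_incl P' P lo hi i' i L' L HB' HB S' S).
  (* Membership depends only on the box and on which holes occur, so the two inclusions of hole
     lists suffice. *)
  rewrite (hb_mem P lo hi i L HB), (hb_mem P' lo hi i' L' HB').
  split; intros [B N]; split; auto.
Qed.
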